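(* Let $k$ be a field and let $H$ be a numerical semigroup with embedding dimension $n\ge3$ and multiplicity $a$. Suppose that $k[H]/(t^{a})$ is stretched, that $\mathrm{PF}(H)=\{h+\alpha,h+2\alpha,\ldots,h+(n-1)\alpha\}$ for some integers $h\ge0$ and $\alpha>0$, and that $\ell:=a-n+1\ge2$. Suppose further that, with $j=n-1$, the set $$\left\{a,\ \tfrac{h+j\alpha+a}{\ell}\right\}\cup\bigl(\{h+i\alpha+a\mid 1\le i\le n-1\}\setminus\{h+j\alpha+a\}\bigr)$$ is the minimal system of generators of $H$. Put $h_1=\frac{h}{a}$ (in this situation $h_1$ and $\frac{h_1+1+\alpha}{\ell}$ are integers). Let $\mathfrak{m}$ be the graded maximal ideal of $k[H]$ and $\mathrm{gr}(k[H])=\bigoplus_{i\ge0}\mathfrak{m}^i/\mathfrak{m}^{i+1}$. Then: (1) $\mathrm{gr}(k[H])$ is Cohen–Macaulay if and only if $\frac{h_1+1+\alpha}{\ell}\ge\ell$. (2) If $h_1\ge\ell^2-\ell-\alpha$, then $\mathrm{gr}(k[H])$ is Cohen–Macaulay. (3) If $\ell=2$, then $\mathrm{gr}(k[H])$ is Cohen–Macaulay.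
   Context: A numerical semigroup is a submonoid $H$ of $\mathbb{Z}_{\ge0}$ generated by finitely many positive integers with gcd $1$; its embedding dimension is the size of its minimal system of generators and its multiplicity is $\min(H\setminus\{0\})$. $k[H]\subseteq k[t]$ is the $k$-subalgebra generated by $t^s$, $s\in H$; its graded maximal ideal is $(t^s\mid 0<s\in H)$. $\mathrm{PF}(H)=\{\alpha\in\mathbb{Z}\setminus H\mid \alpha+s\in H\text{ for all }0<s\in H\}$. An Artinian local ring with maximal ideal $\mathfrak{n}$ is called stretched if $\mathfrak{n}^2=(0)$ or $\mathfrak{n}^2$ is principal. *)

(* Defs.v *)
From HB Require Import structures.
From mathcomp Require Import all_boot all_order all_algebra.
From mathcomp Require Import mathcomp_extra boolp classical_sets cardinality.

Set Implicit Arguments.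
Unset Strict Implicit.
Unset Printing Implicit Defensive.

Import Order.TTheory GRing.Theory Num.Theory.
Local Open Scope ring_scope.
Local Open Scope classical_set_scope.

Section Ideals.
Variable R : comNzRingType.
Implicit Types (I J M P X Y : set R) (s : seq R).

(* Unlike [idealr_closed], the unit ideal is allowed. *)
Definition ideal I : Prop :=
  I 0 /\ forall a u v, I u -> I v -> I (a * u + v).

Definition ideal_gen X : set R :=
  [set x | exists2 s : seq (R * R),
     (forall c, c \in s -> X c.2) & x = \sum_(c <- s) c.1 * c.2].

Definition ideal_mul I J : set R := ideal_gen [set x * y | x in I & y in J].

Fixpoint ideal_pow I (n : nat) : set R :=
  if n is n'.+1 then ideal_mul I (ideal_pow I n') else setT.

Definition prime_ideal P : Prop :=
  [/\ ideal P, ~ P 1 & forall u v, P (u * v) -> P u \/ P v].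

Definition maximal_ideal M : Prop :=
  [/\ ideal M, ~ M 1 & forall J, ideal J -> ~ J 1 -> M `<=` J -> J = M].

Lemma ideal_gen_ideal X : ideal (ideal_gen X).
Proof.
split; first by exists [::]; rewrite ?big_nil.
move=> a _ _ [s sX ->] [r rX ->].
exists ([seq (a * c.1, c.2) | c <- s] ++ r).
  by move=> c; rewrite mem_cat => /orP[/mapP[d ds ->]|/rX//]; exact: sX ds.
rewrite big_cat big_map mulr_sumr; congr (_ + _).
by apply: eq_bigr => c _; rewrite mulrA.
Qed.

Lemma sub_ideal_gen X : X `<=` ideal_gen X.
Proof.
move=> x Xx; exists [:: (1, x)]; last by rewrite big_seq1 mul1r.
by move=> c; rewrite inE => /eqP->.
Qed.

Lemma idealD I u v : ideal I -> I u -> I v -> I (u + v).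
Proof. by move=> [_ hI] Iu Iv; rewrite -[u]mul1r; exact: hI. Qed.

Lemma idealM I a u : ideal I -> I u -> I (a * u).
Proof. by move=> [I0 hI] Iu; rewrite -[_ * _]addr0; exact: hI. Qed.

Lemma ideal_sum I (T : Type) (r : seq T) (Q : pred T) (F : T -> R) :
  ideal I -> (forall i, Q i -> I (F i)) -> I (\sum_(i <- r | Q i) F i).
Proof.
move=> hI hF; elim/big_ind: _ => //; first by case: hI.
by move=> u v; exact: idealD.
Qed.

Lemma ideal_gen_min X I : ideal I -> X `<=` I -> ideal_gen X `<=` I.
Proof.
move=> hI XI _ [s sX ->]; rewrite big_seq; apply: ideal_sum => // c cs.
by apply: idealM => //; apply/XI/sX.
Qed.

Lemma ideal_pow_ideal I n : ideal (ideal_pow I n).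
Proof. by case: n => [|n]; [split | exact: ideal_gen_ideal]. Qed.

Lemma ideal_pow_mul I m n x y :
  ideal_pow I m x -> ideal_pow I n y -> ideal_pow I (m + n) (x * y).
Proof.
elim: m x y => [|m IHm] x y; first by move=> _; apply: idealM; exact: ideal_pow_ideal.
move=> [s sX ->] yn; rewrite mulr_suml big_seq; apply: ideal_sum.
  exact: ideal_gen_ideal.
move=> c /sX[u Iu [v vm <-]]; rewrite -mulrA -(mulrA u).
apply: idealM; first exact: ideal_gen_ideal.
by apply: sub_ideal_gen; exists u => //; exists (v * y) => //; exact: IHm.
Qed.

Lemma ideal_pow_le I n : ideal_pow I n.+1 `<=` ideal_pow I n.
Proof.
apply: ideal_gen_min; first exact: ideal_pow_ideal.
by move=> _ [u _ [v vn <-]]; apply: idealM => //; exact: ideal_pow_ideal.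
Qed.

End Ideals.

Section CohenMacaulay.
Variable A : comNzRingType.

Definition noetherian : Prop :=
  forall I : set A, ideal I -> exists s : seq A, I = ideal_gen [set` s].

Definition artinian : Prop :=
  forall I : nat -> set A,
    (forall i, ideal (I i)) -> (forall i, I i.+1 `<=` I i) ->
    exists N, forall i, (N <= i)%N -> I i = I N.

Definition prime_chain (P : nat -> set A) (n : nat) : Prop :=
  (forall i, (i <= n)%N -> prime_ideal (P i)) /\
  (forall i, (i < n)%N -> P i `<` P i.+1).

Definition has_height (Q : set A) (n : nat) : Prop :=
  (exists2 P, prime_chain P n & P n = Q) /\
  (forall P m, prime_chain P m -> P m = Q -> (m <= n)%N).

Definition regular_seq (s : seq A) : Prop :=
  ~ ideal_gen [set` s] 1 /\
  forall i, (i < size s)%N -> forall x,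
    ideal_gen [set` take i s] (s`_i * x) -> ideal_gen [set` take i s] x.

(* [n] is the maximal length of a regular sequence of [A] inside [I]. *)
Definition has_depth (I : set A) (n : nat) : Prop :=
  (exists s, [/\ regular_seq s, [set` s] `<=` I & size s = n]) /\
  (forall s, regular_seq s -> [set` s] `<=` I -> (size s <= n)%N).

(* For a maximal ideal [M] of a Noetherian ring, [depth (M, A)] is the depth *)
(* of the local ring [A_M], and the height of [M] is the dimension of [A_M]. *)
Definition cohen_macaulay : Prop :=
  noetherian /\
  forall M : set A, maximal_ideal M ->
    exists2 d, has_height M d & has_depth M d.

Definition stretched : Prop :=
  artinian /\
  exists N : set A,
    [/\ maximal_ideal N,
        forall N', maximal_ideal N' -> N' = N &
        ideal_pow N 2 = [set 0] \/ exists x, ideal_pow N 2 = ideal_gen [set x]].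

End CohenMacaulay.

(* The associated graded ring of a proper ideal [I], the direct sum of the    *)
(* I^i / I^(i+1): polynomials q over R with q_i in I^i for all i, under the   *)
(* polynomial product, modulo those q with q_i in I^(i+1) for all i.          *)
Section AssociatedGraded.
Variables (R : comNzRingType) (I : idealr R).

Definition rees_pred : {pred {poly R}} :=
  fun q => `[< forall i, ideal_pow [set` I] i q`_i >].

Lemma rees_pred_closed : subring_closed rees_pred.
Proof.
split.
- apply/asboolP => i; rewrite coef1; case: i => [|i] //=.
  by case: (ideal_pow_ideal [set` I] i.+1).
- move=> p q /asboolP hp /asboolP hq; apply/asboolP => i.
  rewrite coefB addrC -mulN1r.
  by case: (ideal_pow_ideal [set` I] i) => _; exact.
- move=> p q /asboolP hp /asboolP hq; apply/asboolP => i.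
  rewrite coefM; apply: ideal_sum; first exact: ideal_pow_ideal.
  move=> j _; rewrite -{1}(subnKC (ltnSE (ltn_ord j))).
  exact: ideal_pow_mul.
Qed.

HB.instance Definition _ :=
  GRing.isSubringClosed.Build {poly R} rees_pred rees_pred_closed.

Record rees := Rees { rees_val :> {poly R}; _ : rees_val \in rees_pred }.

HB.instance Definition _ := [isSub for rees_val].
HB.instance Definition _ := [Choice of rees by <:].
HB.instance Definition _ := [SubChoice_isSubComNzRing of rees by <:].

Definition rees_succ : {pred rees} :=
  fun q => `[< forall i, ideal_pow [set` I] i.+1 (rees_val q)`_i >].

Lemma rees_succ_closed : idealr_closed rees_succ.
Proof.
split.
- apply/asboolP => i; rewrite coef0.
  by case: (ideal_pow_ideal [set` I] i.+1).
- apply/asboolP => /(_ 0%N); rewrite coef1 /= => h.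
  suff: [set` I] (1 : R) by rewrite /= idealr1.
  apply: ideal_gen_min h.
    split=> [|a u v /= Iu Iv]; first exact: idealr0.
    by rewrite rpredD // idealMr.
  by move=> _ [u Iu [v _ <-]]; rewrite /= mulrC idealMr.
- move=> a u v /asboolP hu /asboolP hv; apply/asboolP => i; rewrite coefD.
  apply: idealD => //; first exact: ideal_pow_ideal.
  rewrite coefM; apply: ideal_sum; first exact: ideal_pow_ideal.
  move=> j _; rewrite -{1}(subnKC (ltnSE (ltn_ord j))) -addnS.
  apply: ideal_pow_mul => //.
  by have /asboolP := valP a; exact.
Qed.

HB.instance Definition _ := isIdealr.Build rees rees_succ rees_succ_closed.

Definition gr : comNzRingType := {ideal_quot rees_succ}.

End AssociatedGraded.

Definition monoid_gen (G : set nat) : set nat :=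
  [set x | exists2 s : seq nat, [set` s] `<=` G & x = (\sum_(y <- s) y)%N].

Record numerical_semigroup := NumericalSemigroup {
  nsg_set : set nat;
  nsgP : exists s : seq nat,
    [/\ forall x, x \in s -> (0 < x)%N,
        \big[gcdn/0%N]_(x <- s) x = 1%N &
        nsg_set = monoid_gen [set` s]] }.

Section NumericalSemigroup.
Variable H : numerical_semigroup.

Lemma nsg_has_pos : exists s : nat, `[< nsg_set H s /\ (0 < s)%N >].
Proof.
have [[|x s] [s_gt0]] := nsgP H; first by rewrite big_nil.
move=> _ HE; exists x; apply/asboolP; split; last by rewrite s_gt0 ?mem_head.
rewrite HE; exists [:: x]; last by rewrite big_seq1.
by move=> y /=; rewrite inE => /eqP->; rewrite mem_head.
Qed.

Definition multiplicity : nat := ex_minn nsg_has_pos.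

Lemma multiplicity_gt0 : (0 < multiplicity)%N.
Proof. by rewrite /multiplicity; case: ex_minnP => m /asboolP[]. Qed.

Definition minimal_generators (G : set nat) : Prop :=
  monoid_gen G = nsg_set H /\
  forall G' : set nat, G' `<=` G -> monoid_gen G' = nsg_set H -> G' = G.

Definition has_embdim (n : nat) : Prop :=
  exists2 G, minimal_generators G & (G #= `I_n)%card.

Definition inZ (x : int) : Prop := exists2 s : nat, nsg_set H s & x = s%:Z.

Definition PF : set int :=
  [set x | ~ inZ x /\ forall s, nsg_set H s -> (0 < s)%N -> inZ (x + s%:Z)].

End NumericalSemigroup.

Section SemigroupRing.
Variables (k : fieldType) (H : numerical_semigroup).

Definition semigroup_alg : {pred {poly k}} :=
  fun p => `[< forall S : {pred {poly k}},
    GRing.subalg_closed S -> (forall s, nsg_set H s -> 'X^s \in S) -> p \in S >].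

Lemma semigroup_alg_closed : subring_closed semigroup_alg.
Proof.
split.
- by apply/asboolP => S [].
- move=> p q /asboolP hp /asboolP hq; apply/asboolP => S Sc SX.
  have [_ Sl _] := Sc; rewrite addrC -scaleN1r.
  by apply: Sl; [exact: hq | exact: hp].
- move=> p q /asboolP hp /asboolP hq; apply/asboolP => S Sc SX.
  by have [_ _ SM] := Sc; apply: SM; [exact: hp | exact: hq].
Qed.

HB.instance Definition _ :=
  GRing.isSubringClosed.Build {poly k} semigroup_alg semigroup_alg_closed.

Record semigroup_ring :=
  SemigroupRing { sgr_val :> {poly k}; _ : sgr_val \in semigroup_alg }.

HB.instance Definition _ := [isSub for sgr_val].
HB.instance Definition _ := [Choice of semigroup_ring by <:].
HB.instance Definition _ := [SubChoice_isSubComNzRing of semigroup_ring by <:].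

Lemma ideal_gen_closed (X : set semigroup_ring) :
  (forall x, X x -> (sgr_val x)`_0 = 0) ->
  idealr_closed (fun x : semigroup_ring => `[< ideal_gen X x >]).
Proof.
move=> hX; have [g0 gD] := ideal_gen_ideal X.
split; first exact/asboolP.
- apply/asboolP => /(ideal_gen_min (I := [set x | (sgr_val x)`_0 = 0])).
  suff: ideal [set x : semigroup_ring | (sgr_val x)`_0 = 0].
    move=> hI /(_ hI hX) /=; rewrite coef1 /= => /eqP.
    by rewrite oner_eq0.
  split=> [|a u v /= hu hv]; first by rewrite /= coef0.
  by rewrite coefD coefM big_ord1 /= hu hv mulr0 addr0.
- by move=> a u v /asboolP hu /asboolP hv; apply/asboolP; exact: gD.
Qed.

Lemma Xn_coef0 (s : nat) : (0 < s)%N -> ('X^s : {poly k})`_0 = 0.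
Proof. by case: s => // s _; rewrite coefXn. Qed.

Definition graded_max : {pred semigroup_ring} :=
  fun x => `[< ideal_gen [set y : semigroup_ring |
    exists s, [/\ nsg_set H s, (0 < s)%N & sgr_val y = 'X^s]] x >].

Lemma graded_max_closed : idealr_closed graded_max.
Proof.
by apply: ideal_gen_closed => y [s [_ s_gt0 ->]]; exact: Xn_coef0.
Qed.

HB.instance Definition _ :=
  isIdealr.Build semigroup_ring graded_max graded_max_closed.

(* The ideal (t^a) of k[H], with a the multiplicity of H. *)
Definition mult_ideal : {pred semigroup_ring} :=
  fun x => `[< ideal_gen [set y : semigroup_ring |
    sgr_val y = 'X^(multiplicity H)] x >].

Lemma mult_ideal_closed : idealr_closed mult_ideal.
Proof.
apply: ideal_gen_closed => y /= ->; apply: Xn_coef0.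
exact: multiplicity_gt0.
Qed.

HB.instance Definition _ :=
  isIdealr.Build semigroup_ring mult_ideal mult_ideal_closed.

Definition fiber_ring : comNzRingType := {ideal_quot mult_ideal}.

Definition gr_semigroup_ring : comNzRingType := gr graded_max.

End SemigroupRing.

(* Main.v *)
Require Import Defs.
From HB Require Import structures.
From mathcomp Require Import all_boot all_order all_algebra.
From mathcomp Require Import mathcomp_extra boolp classical_sets cardinality.
From mathcomp Require Import zify ring lra.

(* The tangent cone G = gr(k[H]) has the monomial basis (t^s), with t^s in    *)
(* degree ord(s), the largest number of nonzero elements of H with sum s. The *)
(* initial form T of t^a generates the irrelevant ideal up to nilpotents, so  *)
(* that G modulo its nilradical is k[T] and every maximal ideal of G has      *)
(* height 1. Hence G is Cohen-Macaulay iff T is a nonzerodivisor, in which    *)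
(* case G is a torsion-free k[T]-module, that is, iff ord(s + a) = ord(s) + 1 *)
(* for every s in H.                                                          *)
(*                                                                            *)
(* Put b = (h + (n-1) alpha + a) / l. The elements jb with j < l and          *)
(* h + i alpha + a with 1 <= i < n lie in the Apery set of a; they are a in   *)
(* number, so they exhaust it. Thus the residues jb, 0 <= j < l, and the      *)
(* progression h + i alpha partition Z/a, which forces h = 0 and alpha = -b   *)
(* in Z/a. Therefore h = a h1 and b = a m - alpha with l m = h1 + 1 + alpha,  *)
(* and the Apery element w_j congruent to jb is jb - max(0, j - l) m a.       *)
(* If m < l, then (l+1) b = w_(l+1) + m a has order at least l+1 > m+1 while  *)
(* w_(l+1) has order 1. If l <= m, then the function w_j + q a |-> o_j + q,   *)
(* with o_j = j for j <= l and o_j = 1 for j > l, is superadditive, so it is  *)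
(* the order.                                                                 *)

Set Implicit Arguments.
Unset Strict Implicit.
Unset Printing Implicit Defensive.

Import Order.TTheory GRing.Theory Num.Theory.
Local Open Scope ring_scope.
Local Open Scope classical_set_scope.

(** The argument has a ring-theoretic half and a combinatorial half, joined by [gr_cohen_macaulayE].
    On the ring side, [gr_poly] and [lead] exhibit k[T] as a retract of the tangent cone with nil
    kernel, so primes and heights are those of the affine line. If the order function of H grows by
    exactly 1 under adding a, the cone embeds k[T]-linearly in a free module of rank a, and
    [cohen_macaulay_of_coordinates] applies. If not, some nonzero class is killed by T, and
    [not_cohen_macaulay_of_torsion] gives depth 0 at the origin although the height there is 1. On
    the combinatorial side, the pseudo-Frobenius hypothesis determines the Apery set of a. Reading
    it modulo a ([progression_neg], [residues]) yields the integer m with l m = h1 + alpha + 1, so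
    the fraction in the theorem is m. When l <= m, superadditivity ([apery_add]) computes all
    orders; when m < l, the multiple (l+1) b breaks regularity because of [apery_irreducible]. This
    is [order_regularE]. The two sufficient conditions are then arithmetic on m. *)

(** * Ideals, primes and nilpotents in a commutative ring *)

Section IdealFacts.
Variable A : comNzRingType.
Implicit Types (I M P : set A) (x y : A).

Lemma ideal_gen_nil x : ideal_gen [set` ([::] : seq A)] x -> x = 0.
Proof.
move=> [s sX ->]; case: s sX => [|c s] sX; first by rewrite big_nil.
by have := sX c (mem_head _ _).
Qed.

Lemma ideal_gen1 x y : ideal_gen [set` [:: x]] y -> exists z, y = x * z.
Proof.
apply: (ideal_gen_min (I := [set y | exists z, y = x * z])).
  split=> [|a u v /= [z ->] [w ->]]; first by exists 0; rewrite mulr0.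
  by exists (a * z + w); rewrite mulrDr mulrCA.
by move=> u /=; rewrite inE => /eqP ->; exists 1; rewrite mulr1.
Qed.

Lemma ideal_gen_sub (X Y : set A) : X `<=` Y -> ideal_gen X `<=` ideal_gen Y.
Proof.
move=> XY; apply: ideal_gen_min; first exact: ideal_gen_ideal.
by move=> x /XY; exact: sub_ideal_gen.
Qed.

Lemma maximal_is_prime M : maximal_ideal M -> prime_ideal M.
Proof.
move=> [iM M1 maxM]; split=> // u v Muv.
case: (pselect (M u)) => [|nMu]; [by left | right].
pose J := [set x | exists a m, M m /\ x = a * u + m].
have iJ : ideal J.
  split; first by exists 0, 0; split; [case: iM | rewrite mul0r addr0].
  move=> a _ _ [b [m [Mm ->]]] [c [m' [Mm' ->]]].
  exists (a * b + c), (a * m + m'); split; first by case: iM => _; exact.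
  by ring.
case: (pselect (J 1)) => [[a [m [Mm e]]]|nJ1].
  suff -> : v = a * (u * v) + m * v.
    by apply: idealD => //; [|rewrite mulrC]; exact: idealM.
  by rewrite -[LHS]mul1r e; ring.
have MJ : M `<=` J by move=> m Mm; exists 0, m; rewrite mul0r add0r.
have JM := maxM J iJ nJ1 MJ.
by case: nMu; rewrite -JM; exists 1, 0; split; [case: iM | rewrite mul1r addr0].
Qed.

Lemma prime_ideal_exp P x n : prime_ideal P -> P (x ^+ n) -> P x.
Proof.
move=> [_ P1 mP]; elim: n => [|n IH]; first by rewrite expr0.
by rewrite exprS => /mP[].
Qed.

Lemma nilD x y m n : x ^+ m = 0 -> y ^+ n = 0 -> (x + y) ^+ (m + n) = 0.
Proof.
move=> xm yn; rewrite exprDn big1 // => i _.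
case: (leqP n i) => [ni|lin].
  by rewrite -(subnK ni) exprD yn !mulr0 mul0rn.
have mi : (m <= m + n - i)%N by lia.
by rewrite -(subnK mi) exprD xm mulr0 mul0r mul0rn.
Qed.

Lemma nil_sum (T : Type) (r : seq T) (F : T -> A) :
  (forall i, exists N, F i ^+ N = 0) -> exists N, (\sum_(i <- r) F i) ^+ N = 0.
Proof.
move=> nF; elim/big_rec: _ => [|i x _ [m xm]]; first by exists 1%N; rewrite expr1.
have [n Fn] := nF i; exists (n + m)%N; exact: nilD.
Qed.

(** Modulo y, the element x agrees with the nilpotent x - y z. *)
Lemma expr_congr_mul x y z N : (x - y * z) ^+ N = 0 -> exists w, x ^+ N = y * w.
Proof.
move=> e; have := subrXX x (x - y * z) N.
rewrite e subr0 opprB addrCA subrr addr0 -mulrA => ->; by eexists.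
Qed.

End IdealFacts.

(** * Height, depth and Cohen-Macaulayness for a ring retracting onto k[T] with nil kernel *)

Section NilExtensionOfLine.
Variables (k : fieldType) (A : comNzRingType).
Variables (iota : {rmorphism {poly k} -> A}) (pi : {rmorphism A -> {poly k}}).
Hypothesis iotaK : cancel iota pi.
Hypothesis pi_nil : forall x, pi x = 0 -> exists N, x ^+ N = 0.

Implicit Types (M P Q : set A) (s : seq A).

Let P0 : set A := [set x | pi x = 0].

Lemma kernel_prime : prime_ideal P0.
Proof.
split.
- split=> [|a u v]; rewrite /P0 /=; first exact: rmorph0.
  by move=> pu pv; rewrite rmorphD rmorphM pu pv mulr0 addr0.
- by rewrite /P0 /= rmorph1 => /eqP; rewrite oner_eq0.
- move=> u v; rewrite /P0 /= rmorphM => /eqP.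
  by rewrite mulf_eq0 => /orP[]/eqP; [left|right].
Qed.

Lemma kernel_sub_prime P : prime_ideal P -> P0 `<=` P.
Proof.
move=> pP x /pi_nil [N xN]; apply: (prime_ideal_exp (n := N)) => //.
by rewrite xN; case: pP => [[]].
Qed.

Lemma kernel_not_maximal : ~ maximal_ideal P0.
Proof.
move=> [_ _ maxP0]; pose J := [set x | (pi x)`_0 = 0].
have JP0 : J = P0.
  apply: maxP0.
  - split=> [|a u v /= pu pv]; first by rewrite /J /= rmorph0 coef0.
    by rewrite /J /= rmorphD rmorphM coefD coefM big_ord1 pu pv mulr0 addr0.
  - by rewrite /J /= rmorph1 coef1 => /eqP; rewrite oner_eq0.
  - by move=> x; rewrite /P0 /J /= => ->; rewrite coef0.
have : J (iota 'X) by rewrite /J /= iotaK coefX.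
by rewrite JP0 /P0 /= iotaK => /eqP; rewrite polyX_eq0.
Qed.

Lemma kernel_proper_maximal M : maximal_ideal M -> P0 `<` M.
Proof.
move=> maxM; have pM := maximal_is_prime maxM.
have P0M := kernel_sub_prime pM; split=> // MP0.
apply: kernel_not_maximal; suff <- : M = P0 by [].
exact/seteqP.
Qed.

(* Modulo a nonzero [X], the powers of the ideal [(Y)] of [k[T]] stabilise. *)
Lemma poly_power_stabilises (X Y : {poly k}) : X != 0 ->
  exists v B, X %| Y ^+ v * (1 - B * Y).
Proof.
move=> X0; case: (eqVneq Y 0) => [->|Y0].
  by exists 1%N, 0; rewrite expr1 mul0r dvdp0.
(* [gdcop Y X] is the largest divisor of X prime to Y. A Bezout relation makes it divide some 1 - B
   Y, and the remaining factors of X divide a power of Y. *)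
have /Bezout_coprimepP[[u v]] := coprimep_gdco Y X0.
rewrite -size_poly_eq1 /= => /size_poly1P[c c0 e].
exists (size X), (c^-1 *: v).
have -> : 1 - c^-1 *: v * Y = gdcop Y X * (c^-1 *: u).
  have -> : 1 = c^-1 *: c%:P :> {poly k} by rewrite -mul_polyC -polyCM mulVf.
  by rewrite -e scalerDr -!scalerAl addrK -!scalerAr mulrC.
by rewrite mulrA dvdp_mulr // mulrC dvdp_gdcor.
Qed.

Lemma power_stabilises_mod x y : pi x <> 0 ->
  exists v b z, pi (y ^+ v * (1 - b * y) - x * z) = 0.
Proof.
move=> /eqP/(poly_power_stabilises (pi y))[v [B /dvdpP[q e]]].
exists v, (iota B), (iota q).
rewrite rmorphB !rmorphM rmorphXn rmorphB rmorph1 rmorphM !iotaK e.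
by rewrite mulrC subrr.
Qed.

(** For y in Q, some y^v (1 - b y) lies in P. Either y is in P, or 1 - b y is in P and hence in Q,
    which would put 1 in Q. *)
Lemma prime_above_nonkernel_maximal P Q : prime_ideal P -> prime_ideal Q ->
  P0 `<` P -> P `<=` Q -> Q `<=` P.
Proof.
move=> pP pQ [P0P nPP0] PQ y Qy.
have [x Px px0] : exists2 x, P x & pi x <> 0.
  apply: contrapT => hn; apply: nPP0 => x Px; apply: contrapT => px.
  by apply: hn; exists x.
have [v [b [z e]]] := power_stabilises_mod y px0.
have [iP _ mP] := pP.
have : P (y ^+ v * (1 - b * y)).
  rewrite -[X in P X](subrK (x * z)); apply: idealD => //.
    exact: kernel_sub_prime.
  by rewrite mulrC; exact: idealM.
move=> /mP[|/PQ Q1]; first exact: prime_ideal_exp.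
have [iQ Q1' _] := pQ; case: Q1'.
by rewrite -(subrK (b * y) 1); apply: idealD => //; exact: idealM.
Qed.

Lemma maximal_height1 M : maximal_ideal M -> has_height M 1.
Proof.
move=> maxM; have pM := maximal_is_prime maxM; split.
  exists (fun i => if i is 0%N then P0 else M) => //; split=> [[|i]|[|i]] //=.
    by move=> _; exact: kernel_prime.
  by move=> _; exact: kernel_proper_maximal.
move=> P m [pP cP] PmM; rewrite leqNgt; apply/negP => m2.
have p0 := pP 0%N isT; have p1 := pP 1%N (ltnW m2); have p2 := pP 2%N m2.
have [s01 n01] := cP 0%N (ltnW m2); have [s12 n12] := cP 1%N m2.
apply: n12; apply: prime_above_nonkernel_maximal => //.
have s0 := kernel_sub_prime p0; split; first exact: subset_trans s01.
by move=> s10; apply: n01; exact: subset_trans s0.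
Qed.

(** If x, y began a regular sequence in M, then x would not be nilpotent, so a power of y^v (1 - b
    y) would be a multiple of x. Cancelling y modulo x leaves a power of 1 - b y in M, which is
    impossible since y is in M. *)
Lemma regular_seq_size_le1 M s : maximal_ideal M ->
  regular_seq s -> [set` s] `<=` M -> (size s <= 1)%N.
Proof.
move=> maxM [s1 reg] sM; have pM := maximal_is_prime maxM.
case: s s1 reg sM => [|x [|y s]] //= s1 reg sM; exfalso.
have [iM M1 _] := pM.
have Mx : M x by apply: sM; rewrite /= mem_head.
have My : M y by apply: sM; rewrite /= !inE eqxx orbT.
have regx u : x * u = 0 -> u = 0.
  move=> e; apply: ideal_gen_nil; apply: (reg 0%N isT).
  by rewrite /= e; case: (ideal_gen_ideal [set` [::] : seq A]).
have px0 : pi x <> 0.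
  move=> /pi_nil[N]; elim: N => [|N IH]; last by rewrite exprS => /regx.
  by rewrite expr0 => /eqP; rewrite oner_eq0.
have regy u : ideal_gen [set` [:: x]] (y * u) -> ideal_gen [set` [:: x]] u.
  exact: (reg 1%N isT).
have [v [b [z /pi_nil[N e]]]] := power_stabilises_mod y px0.
have [w] := expr_congr_mul e; rewrite exprMn -exprM => e2.
have : ideal_gen [set` [:: x]] ((1 - b * y) ^+ N).
  have : ideal_gen [set` [:: x]] (y ^+ (v * N) * (1 - b * y) ^+ N).
    rewrite e2 mulrC; apply: idealM; first exact: ideal_gen_ideal.
    by apply: sub_ideal_gen; rewrite /= mem_head.
  elim: (v * N)%N => [|m IH]; first by rewrite expr0 mul1r.
  by rewrite exprS -mulrA => /regy.
case/ideal_gen1 => u e3; apply: M1; rewrite -(subrK (b * y) 1).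
apply: idealD => //; last exact: idealM.
by apply: (prime_ideal_exp (n := N)) => //; rewrite e3 mulrC; exact: idealM.
Qed.

Lemma maximal_depth1 M : (forall f x, f != 0 -> iota f * x = 0 -> x = 0) ->
  maximal_ideal M -> has_depth M 1.
Proof.
move=> regf maxM; have pM := maximal_is_prime maxM; have [iM M1 _] := pM.
split; last by move=> s; exact: regular_seq_size_le1.
have [P0M nMP0] := kernel_proper_maximal maxM.
have [x Mx px0] : exists2 x, M x & pi x <> 0.
  apply: contrapT => hn; apply: nMP0 => x Mx; apply: contrapT => px.
  by apply: hn; exists x.
have Mf : M (iota (pi x)).
  rewrite -[X in M X](subrK x); apply: idealD => //; apply: P0M.
  by rewrite /P0 /= rmorphB iotaK subrr.
have sM : [set` [:: iota (pi x)]] `<=` M.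
  by move=> u /=; rewrite inE => /eqP->.
exists [:: iota (pi x)]; split=> //; split.
  by move=> /(ideal_gen_min iM sM).
move=> [|//] _ u /= /ideal_gen_nil/regf -> //; last exact/eqP.
by case: (ideal_gen_ideal [set` [::] : seq A]).
Qed.

(** The coordinates embed A in the free module k[T]^r. Torsion-freeness gives depth 1, and ideals
    are finitely generated because submodules of a free module of finite rank over k[T] are. *)
Lemma cohen_macaulay_of_coordinates r (coord : A -> 'I_r -> {poly k}) :
  (forall f x y i, coord (iota f * x + y) i = f * coord x i + coord y i) ->
  (forall x, (forall i, coord x i = 0) -> x = 0) ->
  cohen_macaulay A.
Proof.
move=> cD c_inj.
have c0 i : coord 0 i = 0.
  have := cD 1 0 0 i; rewrite mulr0 addr0 mul1r => /eqP.
  by rewrite -[X in X == _]addr0 (inj_eq (addrI _)) eq_sym => /eqP.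
split; last first.
  move=> M maxM; exists 1%N; first exact: maximal_height1.
  apply: maximal_depth1 => // f x f0 e; apply: c_inj => i.
  have := cD f x 0 i; rewrite e addr0 c0 addr0 => /esym/eqP.
  by rewrite mulf_eq0 (negPf f0) => /eqP.
move=> I iI.
(* Filter I by the number of leading coordinates that vanish; generators are added one coordinate at
   a time, starting from the last. *)
pose L j := [set x | I x /\ forall i : 'I_r, (i < j)%N -> coord x i = 0].
suff gen d j : (j + d = r)%N ->
    exists s : seq A, [set` s] `<=` I /\ L j `<=` ideal_gen [set` s].
  have [s [sI sL]] := gen r 0%N (add0n r); exists s; apply/seteqP; split=> x.
    by move=> Ix; apply: sL; split.
  exact: ideal_gen_min.
elim: d j => [|d IH] j jr.
  exists [::]; split=> // x [_ xL]; rewrite (c_inj x).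
    by case: (ideal_gen_ideal [set` [::] : seq A]).
  by move=> i; apply: xL; rewrite -[j]addn0 jr.
have [|s [sI sL]] := IH j.+1; first by rewrite addSnnS.
have lt_jr : (j < r)%N by rewrite -jr addnS ltnS leq_addr.
pose jo := Ordinal lt_jr.
have LS x : L j x -> coord x jo = 0 -> L j.+1 x.
  move=> [Ix xL] xj; split=> // i; rewrite ltnS leq_eqVlt => /orP[/eqP ij|/xL//].
  by rewrite (_ : i = jo) //; exact: val_inj.
case: (pselect (exists x, L j x /\ coord x jo != 0)) => [|hn]; last first.
  exists s; split=> // x Lx; apply: sL; apply: LS => //.
  by apply: contrapT => /eqP h; apply: hn; exists x.
move=> hx.
(* Take x0 whose coordinate at j is nonzero of least degree; the Euclidean remainder of any other
   such coordinate by it must vanish. *)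
pose good m := `[< exists x, [/\ L j x, coord x jo != 0 & size (coord x jo) = m] >].
have exg : exists m, good m.
  by have [x [Lx x0]] := hx; exists (size (coord x jo)); apply/asboolP; exists x.
case: (ex_minnP exg) => m /asboolP[x0 [[Ix0 Lx0] nz sz]] minm.
exists (x0 :: s); split.
  by move=> u /=; rewrite inE => /orP[/eqP->//|]; exact: sI.
move=> x [Ix Lx]; pose f := coord x jo %/ coord x0 jo.
have cE i : coord (iota (- f) * x0 + x) i = coord x i - f * coord x0 i.
  by rewrite cD mulNr addrC.
have Ly : L j (iota (- f) * x0 + x).
  split; first by apply: idealD => //; exact: idealM.
  by move=> i ij; rewrite cE Lx // Lx0 // mulr0 subr0.
have yj : coord (iota (- f) * x0 + x) jo = 0.
  apply: contrapT => /eqP y0.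
  have : good (size (coord (iota (- f) * x0 + x) jo)).
    by apply/asboolP; eexists; split; [exact: Ly| |].
  move/minm; rewrite -sz cE {1}(divp_eq (coord x jo) (coord x0 jo)) addrC addKr.
  by rewrite leqNgt ltn_modp nz.
have := sL _ (LS _ Ly yj).
rewrite -[X in _ -> ideal_gen _ X](subrK (iota (- f) * x0 + x)) => h.
apply: idealD; first exact: ideal_gen_ideal.
  rewrite opprD addrCA subrr addr0 -mulNr; apply: idealM; first exact: ideal_gen_ideal.
  by apply: sub_ideal_gen; rewrite /= mem_head.
by apply: ideal_gen_sub h => u /= us; rewrite inE us orbT.
Qed.

(* Some power of any element of the maximal ideal lying over [(T)] is a *)
(* multiple of [iota 'X], so that ideal consists of zero divisors.      *)
Lemma not_cohen_macaulay_of_torsion w :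
  w <> 0 -> iota 'X * w = 0 -> ~ cohen_macaulay A.
Proof.
move=> w0 Tw [_ cm]; pose M := [set x | (pi x)`_0 = 0].
have iM : ideal M.
  split=> [|a u v /= pu pv]; first by rewrite /M /= rmorph0 coef0.
  by rewrite /M /= rmorphD rmorphM coefD coefM big_ord1 pu pv mulr0 addr0.
have maxM : maximal_ideal M.
  split=> //; first by rewrite /M /= rmorph1 coef1 => /eqP; rewrite oner_eq0.
  move=> J iJ J1 MJ; apply/seteqP; split=> // x Jx; apply: contrapT => /eqP x0.
  apply: J1; set c := (pi x)`_0 in x0.
  have Jc : J (iota c%:P).
    rewrite -[X in J X](subrK x); apply: idealD => //; apply: MJ.
    by rewrite /M /= rmorphB iotaK coefB coefC subrr.
  rewrite -(rmorph1 iota) -[1](_ : c^-1%:P * c%:P = _); last first.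
    by rewrite -polyCM mulVf.
  by rewrite rmorphM; exact: idealM.
have [d ht dp] := cm M maxM.
have [[P chP PM] _] := maximal_height1 maxM.
(* The height is at least 1, so the supposed common value d of height and depth provides a regular z
   in M. A power of z is divisible by T and so kills w. *)
have [_ htmax] := ht; have d1 := htmax P 1%N chP PM.
have [[s [[s1 reg] sM sz]] _] := dp.
case: s s1 reg sM sz => [|z s] s1 reg sM sz; first by rewrite -sz in d1.
have regz u : z * u = 0 -> u = 0.
  move=> e; apply: ideal_gen_nil; apply: (reg 0%N isT).
  by rewrite /= e; case: (ideal_gen_ideal [set` [::] : seq A]).
have Mz : (pi z)`_0 = 0 by apply: sM; rewrite /= mem_head.
have [q qE] : exists q, pi z = 'X * q.
  have : root (pi z) 0 by rewrite /root horner_coef0 Mz.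
  by case/factor_theorem => q ->; exists q; rewrite subr0 mulrC.
have : pi (z - iota 'X * iota q) = 0.
  by rewrite rmorphB rmorphM !iotaK qE subrr.
case/pi_nil => N /expr_congr_mul[u zN].
apply: w0; have : z ^+ N * w = 0 by rewrite zN mulrAC Tw mul0r.
elim: N {zN} => [|N IH]; first by rewrite expr0 mul1r.
by rewrite exprS -mulrA => /regz.
Qed.

End NilExtensionOfLine.

(** * The order function of a numerical semigroup *)

Section Order.
Variable H : numerical_semigroup.
Local Notation a := (multiplicity H).

Lemma nsg0 : nsg_set H 0%N.
Proof. by have [s [_ _ ->]] := nsgP H; exists [::]; rewrite ?big_nil. Qed.

Lemma nsgD u v : nsg_set H u -> nsg_set H v -> nsg_set H (u + v)%N.
Proof.
have [s [_ _ ->]] := nsgP H => -[r rs ->] [t ts ->].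
exists (r ++ t); last by rewrite big_cat.
by move=> x /=; rewrite mem_cat => /orP[/rs|/ts].
Qed.

Lemma nsgMn n u : nsg_set H u -> nsg_set H (n * u)%N.
Proof.
by move=> Hu; elim: n => [|n IH]; [exact: nsg0 | rewrite mulSn; exact: nsgD].
Qed.

Lemma nsg_multiplicity : nsg_set H a.
Proof. by rewrite /multiplicity; case: ex_minnP => m /asboolP[]. Qed.

Lemma multiplicity_le u : nsg_set H u -> (0 < u)%N -> (a <= u)%N.
Proof.
move=> Hu u0; rewrite /multiplicity; case: ex_minnP => m _; apply.
exact/asboolP.
Qed.

(* [t ^ s] lies in the [i]-th power of the graded maximal ideal of [k[H]]. *)
Fixpoint order_ge (i s : nat) : Prop :=
  if i is i'.+1
  then exists u v, [/\ nsg_set H u, (0 < u)%N, order_ge i' v & s = (u + v)%N]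
  else nsg_set H s.

Lemma order_ge_nsg i s : order_ge i s -> nsg_set H s.
Proof.
by elim: i s => [//|i IH] s /= [u [v [Hu _ /IH Hv ->]]]; exact: nsgD.
Qed.

Lemma order_geD i j s t :
  order_ge i s -> order_ge j t -> order_ge (i + j) (s + t).
Proof.
elim: i s => [|i IH] s /=; last first.
  move=> [u [v [Hu u0 iv ->]]] jt; exists u, (v + t)%N.
  by split; rewrite ?addnA //; exact: IH.
rewrite add0n; elim: j t => [|j IH] t Hs /=; first exact: nsgD.
move=> [u [v [Hu u0 jv ->]]]; exists u, (s + v)%N.
by split; rewrite ?(addnCA s) //; exact: IH.
Qed.

Lemma order_geMn n i s : order_ge i s -> order_ge (n * i) (n * s).
Proof.
move=> is_; elim: n => [|n IH]; first exact: nsg0.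
by rewrite !mulSn; exact: order_geD.
Qed.

Lemma order_ge_le i j s : (i <= j)%N -> order_ge j s -> order_ge i s.
Proof.
elim: i j s => [|i IH] j s; first by move=> _; exact: order_ge_nsg.
case: j => //= j ij [u [v [Hu u0 jv ->]]]; exists u, v.
by split=> //; exact: IH jv.
Qed.

Lemma order_ge_mul i s : order_ge i s -> (i * a <= s)%N.
Proof.
elim: i s => [//|i IH] s /= [u [v [Hu u0 /IH iv ->]]].
by rewrite mulSn leq_add // multiplicity_le.
Qed.

Lemma order_ge_muln n u : nsg_set H u -> (0 < u)%N -> order_ge n (n * u).
Proof.
move=> Hu u0; elim: n => [|n IH]; first exact: nsg0.
by exists u, (n * u)%N; rewrite mulSn.
Qed.

Lemma order_ge_leq i s : order_ge i s -> (i <= s)%N.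
Proof.
move/order_ge_mul; apply: leq_trans.
by rewrite leq_pmulr // multiplicity_gt0.
Qed.

(** The finite range loses nothing by [order_ge_leq]; outside H the value is 0. *)
Definition order s : nat := \max_(i < s.+1 | `[< order_ge i s >]) i.

Lemma order_geE i s : nsg_set H s -> order_ge i s <-> (i <= order s)%N.
Proof.
move=> Hs; split=> [is_|].
  have lt_is : (i < s.+1)%N by rewrite ltnS; exact: order_ge_leq.
  by apply: (leq_bigmax_cond (Ordinal lt_is)); exact/asboolP.
move=> le; apply: order_ge_le le _; rewrite /order.
have [|j jP ->] := @eq_bigmax_cond 'I_s.+1
  [pred i : 'I_s.+1 | `[< order_ge i s >]] (fun i => i : nat).
  by apply/card_gt0P; exists ord0; apply/asboolP.
exact/asboolP.
Qed.

End Order.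

(** * Monomial description of k[H], its Rees algebra and its tangent cone *)

Section TangentCone.
Local Open Scope quotient_scope.
Variables (k : fieldType) (H : numerical_semigroup).
Local Notation a := (multiplicity H).
Local Notation SR := (semigroup_ring k H).
Local Notation sgr_val := Defs.sgr_val.
Local Notation m := [set` @graded_max k H].
Local Notation Rees := (rees (@graded_max k H)).
Local Notation G := (gr_semigroup_ring k H).
Implicit Types (p q : Rees).

Lemma semigroup_algE (f : {poly k}) :
  f \in semigroup_alg H <-> forall s, f`_s != 0 -> nsg_set H s.
Proof.
split.
  pose S : {pred {poly k}} := fun f => `[< forall s, f`_s != 0 -> nsg_set H s >].
  move=> /asboolP/(_ S) h; apply/asboolP; apply: h.
    split.
    - apply/asboolP => s; rewrite coef1; case: s => [|s]; last by rewrite eqxx.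
      by move=> _; exact: nsg0.
    - move=> c u v /asboolP hu /asboolP hv; apply/asboolP => s.
      rewrite coefD coefZ; case: (eqVneq u`_s 0) => [->|/hu//].
      by rewrite mulr0 add0r; exact: hv.
    - move=> u v /asboolP hu /asboolP hv; apply/asboolP => s; rewrite coefM => nz.
      apply: contrapT => nHs; case/eqP: nz; apply: big1 => i _.
      case: (eqVneq u`_i 0) => [->|/hu Hi]; first by rewrite mul0r.
      case: (eqVneq v`_(s - i) 0) => [->|/hv Hj]; first by rewrite mulr0.
      by case: nHs; rewrite -(subnKC (ltnSE (ltn_ord i))); exact: nsgD.
  move=> s Hs; apply/asboolP => t; rewrite coefXn.
  by case: (eqVneq t s) => [->//|_]; rewrite eqxx.
move=> hf; apply/asboolP => S [S1 Sl SM] SX.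
have S0 : 0 \in S by rewrite -(subrr 1) addrC -scaleN1r; exact: Sl.
rewrite -[f]coefK poly_def; elim/big_rec: _ => // i g _ Sg.
case: (eqVneq f`_i 0) => [->|/hf Hi]; first by rewrite scale0r add0r.
exact: Sl (SX _ Hi) Sg.
Qed.

Lemma sgr_supp (x : SR) s : (sgr_val x)`_s != 0 -> nsg_set H s.
Proof. by have /semigroup_algE := valP x; exact. Qed.

(** The monomial c t^s of k[H], with default 0 when s is not in H. *)
Definition smon s (c : k) : SR := insubd 0 (c *: 'X^s).

Lemma smonE s c : nsg_set H s -> sgr_val (smon s c) = c *: 'X^s.
Proof.
move=> Hs; rewrite -[sgr_val _]/(val _) val_insubd ifT //.
apply/semigroup_algE => t; rewrite coefZ coefXn.
by case: (eqVneq t s) => [->//|_]; rewrite mulr0 eqxx.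
Qed.

Lemma sgr_valM (x y : SR) : sgr_val (x * y) = sgr_val x * sgr_val y.
Proof. exact: (rmorphM (val : SR -> {poly k})). Qed.

Lemma sgr_valD (x y : SR) : sgr_val (x + y) = sgr_val x + sgr_val y.
Proof. exact: (rmorphD (val : SR -> {poly k})). Qed.

Lemma sgr_val0 : sgr_val (0 : SR) = 0.
Proof. exact: (rmorph0 (val : SR -> {poly k})). Qed.

Lemma sgr_val1 : sgr_val (1 : SR) = 1.
Proof. exact: (rmorph1 (val : SR -> {poly k})). Qed.

Lemma sgr_val_sum (I : Type) (r : seq I) (F : I -> SR) :
  sgr_val (\sum_(i <- r) F i) = \sum_(i <- r) sgr_val (F i).
Proof. exact: (rmorph_sum (val : SR -> {poly k})). Qed.

Lemma order_ideal i :
  ideal [set x : SR | forall s, (sgr_val x)`_s != 0 -> order_ge H i s].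
Proof.
split=> [s|c u v /= hu hv s]; first by rewrite sgr_val0 coef0 eqxx.
rewrite coefD => nz.
case: (eqVneq (sgr_val v)`_s 0) => [v0|/hv//].
rewrite v0 addr0 coefM in nz; apply: contrapT => ns; case/eqP: nz.
apply: big1 => j _.
case: (eqVneq (sgr_val c)`_j 0) => [->|/sgr_supp Hj]; first by rewrite mul0r.
case: (eqVneq (sgr_val u)`_(s - j) 0) => [->|/hu Hu]; first by rewrite mulr0.
case: ns; rewrite -(subnKC (ltnSE (ltn_ord j))) -[i]add0n.
exact: order_geD.
Qed.

(** The powers of the maximal ideal are monomial ideals, so membership is decided exponent by
    exponent. *)
Lemma ideal_powE i (x : SR) : ideal_pow m i x <->
  forall s, (sgr_val x)`_s != 0 -> order_ge H i s.
Proof.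
split.
  elim: i x => [|i IH] x; first by move=> _ s; exact: sgr_supp.
  move: x; apply: ideal_gen_min; first exact: order_ideal.
  move=> _ [u /asboolP mu [v /IH hv <-]] s; rewrite sgr_valM coefM => nz.
  have {}mu : forall t, (sgr_val u)`_t != 0 -> nsg_set H t /\ (0 < t)%N.
    move=> t ut; have Ht := sgr_supp ut; split=> //.
    case: t {Ht} ut => // /eqP; case; move: u mu {nz}; apply: ideal_gen_min.
      split=> [|c u w /= u0 w0]; first by rewrite /= coef0.
      by rewrite coefD coefM big_ord1 u0 w0 mulr0 addr0.
    by move=> u [t [_ t0 ->]]; exact: Xn_coef0.
  apply: contrapT => ns; case/eqP: nz; apply: big1 => j _.
  case: (eqVneq (sgr_val u)`_j 0) => [->|/mu [Hj j0]]; first by rewrite mul0r.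
  case: (eqVneq (sgr_val v)`_(s - j) 0) => [->|/hv Hv]; first by rewrite mulr0.
  by case: ns; exists j, (s - j)%N; rewrite (subnKC (ltnSE (ltn_ord j))).
move=> hx.
have mon s c : order_ge H i s -> ideal_pow m i (smon s c).
  elim: i s c {hx} => [//|i IH] s c /= [u [v [Hu u0 iv ->]]].
  have Hv := order_ge_nsg iv; apply: sub_ideal_gen.
  exists (smon u 1).
    by apply/asboolP/sub_ideal_gen; exists u; rewrite smonE // scale1r.
  exists (smon v c); first exact: IH.
  apply: val_inj; rewrite /= !smonE //; last exact: nsgD.
  by rewrite scale1r -scalerAr exprD.
suff -> : x = \sum_(s < size (sgr_val x)) smon s (sgr_val x)`_s.
  apply: ideal_sum => [|s _]; first exact: ideal_pow_ideal.
  case: (eqVneq (sgr_val x)`_s 0) => [->|/hx/mon//].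
  suff -> : smon s 0 = 0 by case: (ideal_pow_ideal m i).
  rewrite /smon scale0r; apply: val_inj; rewrite val_insubd /=.
  by case: ifP; rewrite // sgr_val0.
apply: val_inj; rewrite [RHS]sgr_val_sum -[LHS]coefK poly_def.
apply: eq_bigr => s _; case: (eqVneq (sgr_val x)`_s 0) => [->|nz].
  by rewrite /smon scale0r -[RHS]/(val _) val_insubd; case: ifP; rewrite // sgr_val0.
by rewrite smonE //; exact: sgr_supp nz.
Qed.

Lemma rees_valM p q : rees_val (p * q) = rees_val p * rees_val q.
Proof. exact: (rmorphM (val : Rees -> {poly SR})). Qed.

Lemma rees_valD p q : rees_val (p + q) = rees_val p + rees_val q.
Proof. exact: (rmorphD (val : Rees -> {poly SR})). Qed.

Lemma rees_val0 : rees_val (0 : Rees) = 0.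
Proof. exact: (rmorph0 (val : Rees -> {poly SR})). Qed.

Lemma rees_val1 : rees_val (1 : Rees) = 1.
Proof. exact: (rmorph1 (val : Rees -> {poly SR})). Qed.

Definition cf q i s : k := (sgr_val (rees_val q)`_i)`_s.

Lemma cf_order q i s : cf q i s != 0 -> order_ge H i s.
Proof.
by have /asboolP/(_ i)/ideal_powE := valP q; exact.
Qed.

Lemma cf_ext p q : (forall i s, cf p i s = cf q i s) -> p = q.
Proof.
move=> e; apply: val_inj; apply/polyP => i; apply: val_inj; apply/polyP => s.
exact: e.
Qed.

Lemma cf0 i s : cf 0 i s = 0.
Proof. by rewrite /cf rees_val0 coef0 sgr_val0 coef0. Qed.

Lemma cf1 i s : cf 1 i s = ((i == 0%N) && (s == 0%N))%:R.
Proof.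
rewrite /cf rees_val1 coef1.
case: i => [|i]; first by rewrite sgr_val1 coef1.
by rewrite -[_`_s]/((sgr_val (0 : SR))`_s) sgr_val0 coef0.
Qed.

Lemma cfD p q i s : cf (p + q) i s = cf p i s + cf q i s.
Proof.
by rewrite /cf rees_valD coefD sgr_valD coefD.
Qed.

Lemma cfN p i s : cf (- p) i s = - cf p i s.
Proof. by apply/eqP; rewrite -addr_eq0 -cfD addNr cf0. Qed.

Lemma cf_sum (I : Type) (r : seq I) (F : I -> Rees) i s :
  cf (\sum_(j <- r) F j) i s = \sum_(j <- r) cf (F j) i s.
Proof.
apply: (big_morph (fun q => cf q i s)) => [p q|]; [exact: cfD | exact: cf0].
Qed.

Lemma cfM p q i s : cf (p * q) i s =
  \sum_(j < i.+1) \sum_(u < s.+1) cf p j u * cf q (i - j) (s - u).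
Proof.
rewrite /cf rees_valM coefM sgr_val_sum coef_sum.
by apply: eq_bigr => j _; rewrite sgr_valM coefM.
Qed.

Lemma rees_succE q : q \in @rees_succ SR (@graded_max k H) <->
  forall i s, cf q i s != 0 -> order_ge H i.+1 s.
Proof.
split=> [/asboolP h i|h]; first by apply/ideal_powE.
by apply/asboolP => i; apply/ideal_powE; exact: h.
Qed.

(** The monomial c t^s placed in degree i; the default 0 covers the case where it is not in the i-th
    power. *)
Definition rmon i s (c : k) : Rees := insubd 0 (smon s c *: 'X^i).

Lemma cf_rmon i s c j t : order_ge H i s ->
  cf (rmon i s c) j t = if (j == i) && (t == s) then c else 0.
Proof.
move=> is_; have Hs := order_ge_nsg is_.
have cE j' t' : (sgr_val (smon s c *: 'X^i)`_j')`_t' =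
    if (j' == i) && (t' == s) then c else 0.
  rewrite coefZ coefXn; case: (eqVneq j' i) => [_|_]; last first.
    by rewrite mulr0 sgr_val0 coef0.
  rewrite mulr1 smonE // coefZ coefXn.
  by case: (eqVneq t' s); rewrite ?mulr1 ?mulr0.
rewrite /cf -[rees_val _]/(val _) val_insubd ifT //.
apply/asboolP => j'; apply/ideal_powE => t'; rewrite cE.
by case: ifP => [/andP[/eqP-> /eqP->]//|_]; rewrite eqxx.
Qed.

Lemma rmon0 i s : rmon i s 0 = 0.
Proof.
rewrite /rmon /smon scale0r.
have -> : insubd (0 : SR) (0 : {poly k}) = 0.
  by apply: val_inj; rewrite val_insubd; case: ifP.
by rewrite scale0r; apply: val_inj; rewrite val_insubd; case: ifP.
Qed.

Lemma rmonM i s c j t d : order_ge H i s -> order_ge H j t ->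
  rmon i s c * rmon j t d = rmon (i + j) (s + t) (c * d).
Proof.
move=> is_ jt; apply: cf_ext => i' s'; rewrite cf_rmon; last exact: order_geD.
rewrite cfM; case: ifP => [/andP[/eqP-> /eqP->]|ne].
  have li : (i < (i + j).+1)%N by rewrite ltnS leq_addr.
  have ls : (s < (s + t).+1)%N by rewrite ltnS leq_addr.
  rewrite (bigD1 (Ordinal li)) //= (bigD1 (Ordinal ls)) //= !addKn.
  rewrite !cf_rmon // !eqxx /= !big1 ?addr0 //.
    move=> u; rewrite -val_eqE /= => /negPf ui; apply: big1 => v _.
    by rewrite cf_rmon // ui mul0r.
  by move=> u; rewrite -val_eqE /= => /negPf ui; rewrite cf_rmon // ui andbF mul0r.
apply: big1 => u _; apply: big1 => v _; rewrite !cf_rmon //.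
case: ifP => [/andP[/eqP ui /eqP vs]|_]; last by rewrite mul0r.
case: ifP => [/andP[/eqP uj /eqP vt]|_]; last by rewrite mulr0.
move: ne (ltn_ord u) (ltn_ord v); rewrite !ltnS => /negP ne lu lv; case: ne.
by apply/andP; split; apply/eqP; lia.
Qed.

Lemma rmon_exp i s c n : order_ge H i s ->
  rmon i s c ^+ n = rmon (n * i) (n * s) (c ^+ n).
Proof.
move=> is_; elim: n => [|n IH].
  by apply: cf_ext => j t; rewrite expr0 cf1 cf_rmon; [case: ifP | exact: nsg0].
by rewrite exprS IH rmonM ?mulSn ?exprS //; exact: order_geMn.
Qed.

Lemma rees_decomp q : exists M,
  q = \sum_(i < M) \sum_(s < M) rmon i s (cf q i s) /\
  forall i s, cf q i s != 0 -> (i < M)%N && (s < M)%N.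
Proof.
pose M := (size (rees_val q) +
  \max_(i < size (rees_val q)) size (sgr_val (rees_val q)`_i)%R)%N.
have bound i s : cf q i s != 0 -> (i < M)%N && (s < M)%N.
  move=> nz; have iq : (i < size (rees_val q))%N.
    rewrite ltnNge; apply: contra nz => le.
    by rewrite /cf (nth_default _ le) sgr_val0 coef0.
  rewrite (leq_trans iq (leq_addr _ _)) /=.
  apply: leq_trans (leq_addl _ _).
  apply: leq_trans (leq_bigmax (Ordinal iq)).
  by rewrite ltnNge; apply: contra nz => le; rewrite /cf nth_default.
exists M; split=> //; apply: cf_ext => i s; rewrite cf_sum.
have rE (j t : nat) : cf (rmon j t (cf q j t)) i s =
   if (i == j) && (s == t) then cf q i s else 0.
  case: (eqVneq (cf q j t) 0) => [e|/cf_order jt]; last first.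
    by rewrite cf_rmon //; case: ifP => [/andP[/eqP-> /eqP->]|].
  by rewrite e rmon0 cf0; case: ifP => // /andP[/eqP-> /eqP->].
case: (eqVneq (cf q i s) 0) => [e|nz].
  rewrite e; symmetry; apply: big1 => j _; rewrite cf_sum; apply: big1 => t _.
  by rewrite rE e if_same.
have /andP[iM sM] := bound _ _ nz.
rewrite (bigD1 (Ordinal iM)) //= cf_sum (bigD1 (Ordinal sM)) //= rE !eqxx /=.
rewrite !big1 ?addr0 //.
  move=> j; rewrite -val_eqE /= eq_sym => /negPf ji; rewrite cf_sum.
  by apply: big1 => t _; rewrite rE ji.
by move=> t; rewrite -val_eqE /= eq_sym => /negPf ts; rewrite rE ts andbF.
Qed.

(** * The tangent cone as a nil extension of k[T] *)

Implicit Types (x y : G).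

Definition gr_class q : G := \pi_({ideal_quot (@rees_succ SR (@graded_max k H))}) q.

Lemma gr_class_surj x : exists q, x = gr_class q.
Proof. by exists (repr x); rewrite /gr_class reprK. Qed.

Lemma gr_class_eq p q : gr_class p = gr_class q <-> p - q \in @rees_succ SR (@graded_max k H).
Proof. by rewrite Quotient.idealrBE; split=> [/eqP|/eqP]. Qed.

Lemma gr_class_zmod : zmod_morphism gr_class.
Proof. by move=> p q; rewrite /gr_class rmorphB. Qed.

Lemma gr_class_monoid : monoid_morphism gr_class.
Proof. by split=> [|p q]; rewrite /gr_class ?rmorph1 ?rmorphM. Qed.

HB.instance Definition _ := GRing.isZmodMorphism.Build Rees G gr_class gr_class_zmod.
HB.instance Definition _ := GRing.isMonoidMorphism.Build Rees G gr_class gr_class_monoid.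

Lemma gr_class_eq0 q : gr_class q = 0 <-> forall i s, cf q i s != 0 -> order_ge H i.+1 s.
Proof. by rewrite -(rmorph0 gr_class) gr_class_eq subr0 rees_succE. Qed.

Lemma cf_size q i s : (size (rees_val q) <= i)%N -> cf q i s = 0.
Proof. by move=> le; rewrite /cf (nth_default _ le) sgr_val0 coef0. Qed.

Lemma order_ge_multiplicity i : order_ge H i (i * a).
Proof.
by apply: order_ge_muln; [exact: nsg_multiplicity | exact: multiplicity_gt0].
Qed.

(* In degree [i] all exponents are at least [i * a], so that taking the *)
(* coefficient of [t ^ (i * a)] is multiplicative.                      *)
Definition lowest_part q : {poly k} :=
  \poly_(i < size (rees_val q)) cf q i (i * a).

Lemma coef_lowest_part q i : (lowest_part q)`_i = cf q i (i * a).
Proof. by rewrite coef_poly; case: ltnP => // /cf_size ->. Qed.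

Lemma lowest_partB p q : lowest_part (p - q) = lowest_part p - lowest_part q.
Proof. by apply/polyP => i; rewrite coefB !coef_lowest_part cfD cfN. Qed.

Lemma lowest_part1 : lowest_part 1 = 1.
Proof.
apply/polyP => i; rewrite coef_lowest_part cf1 coef1.
by case: i => //= i.
Qed.

Lemma lowest_partM p q : lowest_part (p * q) = lowest_part p * lowest_part q.
Proof.
apply/polyP => i; rewrite coefM coef_lowest_part cfM; apply: eq_bigr => j _.
have ji : (j <= i)%N := ltnSE (ltn_ord j).
have lt_ja : (j * a < (i * a).+1)%N by rewrite ltnS leq_mul2r ji orbT.
rewrite (bigD1 (Ordinal lt_ja)) //= -mulnBl !coef_lowest_part big1 ?addr0 //.
move=> u; rewrite -val_eqE /= => uj.
case: (eqVneq (cf p j u) 0) => [->|/cf_order/order_ge_mul ju]; first by rewrite mul0r.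
case: (eqVneq (cf q (i - j) (i * a - u)) 0) => [->|/cf_order/order_ge_mul].
  by rewrite mulr0.
by move: (ltn_ord u); rewrite mulnBl; move/eqP: uj; lia.
Qed.

Lemma lowest_part_eq0 q : gr_class q = 0 -> lowest_part q = 0.
Proof.
move/gr_class_eq0 => hq; apply/polyP => i; rewrite coef_lowest_part coef0.
apply: contrapT => /eqP/hq/order_ge_mul; rewrite mulSn.
by have := multiplicity_gt0 H; lia.
Qed.

(** The retraction of the cone onto k[T]. The choice of representative is harmless, since
    [lowest_part] vanishes on the ideal divided out. *)
Definition lead x : {poly k} := lowest_part (repr x).

Lemma lead_class q : lead (gr_class q) = lowest_part q.
Proof.
apply/eqP; rewrite -subr_eq0 -lowest_partB; apply/eqP/lowest_part_eq0.
by rewrite rmorphB /= {1}/gr_class reprK subrr.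
Qed.

Lemma lead_zmod : zmod_morphism lead.
Proof.
move=> x y; have [p ->] := gr_class_surj x; have [q ->] := gr_class_surj y.
by rewrite -rmorphB !lead_class lowest_partB.
Qed.

Lemma lead_monoid : monoid_morphism lead.
Proof.
split=> [|x y]; first by rewrite -(rmorph1 gr_class) lead_class lowest_part1.
have [p ->] := gr_class_surj x; have [q ->] := gr_class_surj y.
by rewrite -rmorphM !lead_class lowest_partM.
Qed.

HB.instance Definition _ := GRing.isZmodMorphism.Build G {poly k} lead lead_zmod.
HB.instance Definition _ := GRing.isMonoidMorphism.Build G {poly k} lead lead_monoid.

Definition gr_const (c : k) : G := gr_class (rmon 0 0 c).

Lemma gr_const_zmod : zmod_morphism gr_const.
Proof.
move=> c d; rewrite /gr_const -rmorphB; congr gr_class; apply: cf_ext => i s.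
have o := nsg0 H : order_ge H 0 0.
by rewrite cfD cfN !cf_rmon //; case: ifP => // _; rewrite subrr.
Qed.

Lemma gr_const_monoid : monoid_morphism gr_const.
Proof.
have o := nsg0 H : order_ge H 0 0.
split=> [|c d]; last by rewrite /gr_const -rmorphM rmonM.
rewrite /gr_const -(rmorph1 gr_class); congr gr_class; apply: cf_ext => i s.
by rewrite cf1 cf_rmon //; case: ifP.
Qed.

HB.instance Definition _ := GRing.isZmodMorphism.Build k G gr_const gr_const_zmod.
HB.instance Definition _ := GRing.isMonoidMorphism.Build k G gr_const gr_const_monoid.

Definition gr_var : G := gr_class (rmon 1 a 1).

Lemma gr_var_comm : commr_rmorph gr_const gr_var.
Proof. by move=> c; exact: mulrC. Qed.

Definition gr_poly : {rmorphism {poly k} -> G} := horner_morph gr_var_comm.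

Lemma gr_polyC c : gr_poly c%:P = gr_const c.
Proof. exact: horner_morphC. Qed.

Lemma gr_polyX : gr_poly 'X = gr_var.
Proof. exact: horner_morphX. Qed.

Lemma order_ge1a : order_ge H 1 a.
Proof. by have := order_ge_multiplicity 1; rewrite mul1n. Qed.

Lemma gr_polyK : cancel gr_poly lead.
Proof.
have o := nsg0 H : order_ge H 0 0.
have a0 := multiplicity_gt0 H.
elim/poly_ind => [|f c IH]; first by rewrite !rmorph0.
rewrite [gr_poly _]rmorphD rmorphM gr_polyX gr_polyC rmorphD rmorphM.
rewrite /= IH; congr (_ * _ + _).
  rewrite lead_class; apply/polyP => i; rewrite coef_lowest_part coefX.
  rewrite cf_rmon; last exact: order_ge1a.
  by case: (eqVneq i 1%N) => [->|]; rewrite // mul1n eqxx.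
rewrite lead_class; apply/polyP => i; rewrite coef_lowest_part coefC cf_rmon //.
by case: (eqVneq i 0%N) => [->|]; rewrite // mul0n eqxx.
Qed.

(* A monomial [t ^ s] of order [i] with [s > i * a] is nilpotent, since the *)
(* order of [t ^ (a * s)] is at least [s].                                  *)
Lemma lead_eq0_nil x : lead x = 0 -> exists N, x ^+ N = 0.
Proof.
have [q ->] := gr_class_surj x; rewrite lead_class => q0.
have [M [qE _]] := rees_decomp q.
have -> : gr_class q = \sum_(i < M) \sum_(s < M) gr_class (rmon i s (cf q i s)).
  by rewrite [in LHS]qE rmorph_sum; apply: eq_bigr => i _; rewrite rmorph_sum.
apply: nil_sum => i; apply: nil_sum => s.
case: (eqVneq (cf q i s) 0) => [->|nz].
  by exists 1%N; rewrite expr1 rmon0 rmorph0.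
have is_ := cf_order nz; exists a; rewrite -rmorphXn rmon_exp //.
apply/gr_class_eq0 => j t; rewrite cf_rmon; last exact: order_geMn.
case: ifP => [/andP[/eqP-> /eqP->] _|_]; last by rewrite eqxx.
have ia : (s : nat) <> (i * a)%N.
  by move=> sE; case/eqP: nz; rewrite sE -coef_lowest_part q0 coef0.
have le := order_ge_mul is_.
rewrite [(a * s)%N]mulnC; apply: order_ge_le (order_ge_multiplicity s); lia.
Qed.

(* Each [x] is determined by the coefficients of [t ^ s] in degree [order s]; *)
(* we group them by the residue of [s] modulo [a].                            *)
Definition residue_part q (r : nat) : {poly k} :=
  \poly_(j < (\max_(i < size (rees_val q)) size (sgr_val (rees_val q)`_i)%R)%N)
    (if `[< nsg_set H (r + j * a)%N >]
     then cf q (order H (r + j * a)) (r + j * a) else 0).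

Lemma coef_residue_part q r j : (residue_part q r)`_j =
  if `[< nsg_set H (r + j * a)%N >]
  then cf q (order H (r + j * a)) (r + j * a) else 0.
Proof.
rewrite coef_poly; case: ltnP => // le; case: ifP => // _.
set s := (r + j * a)%N; apply/esym.
case: (ltnP (order H s) (size (rees_val q))) => [ls|/cf_size//].
rewrite /cf nth_default //; apply: (@leq_trans j); last first.
  by rewrite /s; have := leq_pmulr j (multiplicity_gt0 H); lia.
by apply: leq_trans le; exact: (leq_bigmax (Ordinal ls)).
Qed.

Lemma residue_partD p q r :
  residue_part (p + q) r = residue_part p r + residue_part q r.
Proof.
apply/polyP => j; rewrite coefD !coef_residue_part cfD.
by case: ifP; rewrite ?addr0.
Qed.

Lemma residue_part_eq0 q r : gr_class q = 0 -> residue_part q r = 0.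
Proof.
move/gr_class_eq0 => hq; apply/polyP => j; rewrite coef_residue_part coef0.
case: ifP => // /asboolP Hs; apply: contrapT => /eqP/hq/(order_geE _ Hs).
by rewrite ltnn.
Qed.

Lemma cfM_rmon i s c q j t : order_ge H i s ->
  cf (rmon i s c * q) j t =
  if (i <= j)%N && (s <= t)%N then c * cf q (j - i) (t - s) else 0.
Proof.
move=> is_; rewrite cfM; case: ifP => [/andP[ij st]|ne].
  rewrite (bigD1 (Ordinal (ij : (i < j.+1)%N))) //=.
  rewrite (bigD1 (Ordinal (st : (s < t.+1)%N))) //=.
  rewrite cf_rmon // !eqxx /= !big1 ?addr0 //.
    move=> u; rewrite -val_eqE /= => /negPf ui; apply: big1 => v _.
    by rewrite cf_rmon // ui mul0r.
  by move=> u; rewrite -val_eqE /= => /negPf ui; rewrite cf_rmon // ui andbF mul0r.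
apply: big1 => u _; apply: big1 => v _; rewrite cf_rmon //.
case: ifP => [/andP[/eqP ui /eqP vs]|_]; last by rewrite mul0r.
move: ne (ltn_ord u) (ltn_ord v); rewrite ui vs !ltnS => /negP ne lu lv.
by case: ne; rewrite lu.
Qed.

(** * Cohen-Macaulayness of the cone as a condition on orders *)

Section RegularInitialForm.
Hypothesis order_reg : forall i s, nsg_set H s ->
  order_ge H i.+1 (s + a) -> order_ge H i s.

Lemma order_addr s : nsg_set H s -> order H (s + a) = (order H s).+1.
Proof.
move=> Hs; have Hsa := nsgD Hs (nsg_multiplicity H).
have os i : (i <= order H s)%N = (i.+1 <= order H (s + a))%N.
  apply/idP/idP => [/(order_geE _ Hs) h|]; last first.
    by move/(order_geE _ Hsa)/(order_reg Hs)/(order_geE _ Hs).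
  by apply/(order_geE _ Hsa); rewrite -addn1; apply: order_geD => //; exact: order_ge1a.
have := os (order H s); rewrite leqnn => /esym.
have := os (order H (s + a)).-1; rewrite -ltnS; lia.
Qed.

Lemma residue_part_const c q r : 
  residue_part (rmon 0 0 c * q) r = c *: residue_part q r.
Proof.
apply/polyP => j; rewrite coefZ !coef_residue_part; case: ifP => _; last by rewrite mulr0.
by rewrite cfM_rmon ?subn0 //; exact: nsg0.
Qed.

(** T sends t^s in degree [order s] to t^(s+a) in degree [order s + 1], which by [order_addr] is
    again the degree recorded by [residue_part]; hence a plain shift. *)
Lemma residue_part_var q r : (r < a)%N ->
  residue_part (rmon 1 a 1 * q) r = residue_part q r * 'X.
Proof.
move=> ra; apply/polyP => j; rewrite coefMX !coef_residue_part.
rewrite cfM_rmon; last exact: order_ge1a.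
case: j => [|j] /=.
  by rewrite mul0n addn0 (leqNgt a) ra andbF if_same.
rewrite mulSn (addnC a) addnA addnK mul1r leq_addl andbT.
case: (pselect (nsg_set H (r + j * a)%N)) => [Hs|nHs].
  have Hsa := nsgD Hs (nsg_multiplicity H).
  by rewrite order_addr // subn1 !ifT //; apply/asboolP.
rewrite [RHS]ifF; last exact/asboolP.
case: ifP => // _; case: ifP => // _; apply: contrapT.
by move=> /eqP/cf_order/order_ge_nsg.
Qed.

Definition coordinates x (r : 'I_a) : {poly k} := residue_part (repr x) r.

Lemma coordinates_class q r : coordinates (gr_class q) r = residue_part q r.
Proof.
have e : gr_class (repr (gr_class q) + (- q)) = 0 by rewrite rmorphB /= {1}/gr_class reprK subrr.
have := residue_part_eq0 r e; rewrite residue_partD => /eqP.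
have -> : residue_part (- q) r = - residue_part q r.
  by apply/polyP => j; rewrite coefN !coef_residue_part cfN; case: ifP; rewrite ?oppr0.
by rewrite subr_eq0 => /eqP.
Qed.

Lemma coordinates_linear f x y r :
  coordinates (gr_poly f * x + y) r = f * coordinates x r + coordinates y r.
Proof.
have cD u v : coordinates (u + v) r = coordinates u r + coordinates v r.
  have [p ->] := gr_class_surj u; have [q ->] := gr_class_surj v.
  by rewrite -rmorphD !coordinates_class residue_partD.
rewrite cD; congr (_ + _).
elim/poly_ind: f x => [|f c IH] x.
  rewrite rmorph0 !mul0r -(rmorph0 gr_class) coordinates_class.
  by apply/residue_part_eq0/rmorph0.
rewrite rmorphD rmorphM gr_polyX gr_polyC mulrDl -mulrA cD IH mulrDl.
have [q ->] := gr_class_surj x.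
rewrite /gr_var /gr_const -!rmorphM !coordinates_class residue_part_var //.
by rewrite residue_part_const mul_polyC -mulrA ['X * _]mulrC.
Qed.

(** A term t^s in degree i below [order s] is already zero in the cone; in degree [order s] its
    coefficient is read off by the coordinate of s mod a. *)
Lemma coordinates_inj x : (forall r, coordinates x r = 0) -> x = 0.
Proof.
have [q ->] := gr_class_surj x => c0; apply/gr_class_eq0 => i s nz.
have is_ := cf_order nz; have Hs := order_ge_nsg is_.
apply/(order_geE _ Hs); rewrite ltn_neqAle; move/(order_geE _ Hs): (is_) => ->.
rewrite andbT; apply/eqP => iE; case/eqP: nz.
have lt_r : (s %% a < a)%N by rewrite ltn_mod multiplicity_gt0.
have := c0 (Ordinal lt_r); rewrite coordinates_class => /polyP/(_ (s %/ a)%N).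
rewrite coef_residue_part coef0 /= addnC -divn_eq -iE ifT //.
exact/asboolP.
Qed.

Lemma gr_cohen_macaulay : cohen_macaulay G.
Proof.
apply: (cohen_macaulay_of_coordinates gr_polyK lead_eq0_nil coordinates_linear).
exact: coordinates_inj.
Qed.

End RegularInitialForm.

(** The torsion witness is the class of t^s in degree [order s]: times T it lands in degree
    [order s + 1], below the order of s + a. *)
Lemma gr_not_cohen_macaulay i s : nsg_set H s ->
  order_ge H i.+1 (s + a) -> ~ order_ge H i s -> ~ cohen_macaulay G.
Proof.
move=> Hs isa nis; have os : order_ge H (order H s) s by apply/order_geE.
have lt_i : (order H s < i)%N by rewrite ltnNge; apply/negP => /(order_geE _ Hs).
apply: (not_cohen_macaulay_of_torsion gr_polyK lead_eq0_nil
  (w := gr_class (rmon (order H s) s 1))).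
  move/gr_class_eq0/(_ (order H s) s); rewrite cf_rmon // !eqxx oner_eq0.
  by move=> /(_ isT)/(order_geE _ Hs); rewrite ltnn.
rewrite gr_polyX /gr_var -rmorphM rmonM //; last exact: order_ge1a.
apply/gr_class_eq0 => j t; rewrite cf_rmon; last exact: order_geD order_ge1a os.
case: ifP => [/andP[/eqP-> /eqP->] _|_]; last by rewrite eqxx.
by rewrite addnC addnC [(a + s)%N]addnC; apply: order_ge_le isa; lia.
Qed.

Theorem gr_cohen_macaulayE : cohen_macaulay G <->
  forall i s, nsg_set H s -> order_ge H i.+1 (s + a) -> order_ge H i s.
Proof.
split=> [cm i s Hs isa|]; last exact: gr_cohen_macaulay.
by apply: contrapT => /(gr_not_cohen_macaulay Hs isa); apply.
Qed.

End TangentCone.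

(** * Partitioning Z/a into multiples of b and an arithmetic progression *)

Section ResidueProgressions.
Variables (a n l : nat) (h alpha b : 'Z_a).
Hypotheses (a_gt1 : (1 < a)%N) (n_ge3 : (3 <= n)%N) (l_ge2 : (2 <= l)%N).
Hypothesis aE : a = (n - 1 + l)%N.
Local Open Scope ring_scope.
Let S i : 'Z_a := h + i%:R * alpha.
Hypothesis cover : forall x : 'Z_a,
  (exists2 j, (j < l)%N & x = j%:R * b) \/
  (exists2 i, (1 <= i <= n - 1)%N & x = S i).
Hypothesis disjTS : forall i j, (j < l)%N -> (1 <= i <= n - 1)%N -> j%:R * b <> S i.
Hypothesis b_neq0 : b <> 0.
Hypothesis injS12 : S 1 <> S 2.
Hypothesis lbE : l%:R * b = S (n - 1).

Let Sadd i d : S (i + d) = S i + d%:R * alpha.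
Proof. by rewrite /S natrD; ring. Qed.

Let a0 : a%:R = 0 :> 'Z_a.
Proof. by apply: val_inj; rewrite /= val_Zp_nat // modnn. Qed.

Let red x j : x = j%:R * b -> exists2 j', (j' < a)%N & x = j'%:R * b.
Proof.
move=> ->; exists (j %% a)%N; first by rewrite ltn_mod ltnW.
by rewrite {1}(divn_eq j a) natrD natrM a0 mulr0 add0r.
Qed.

(** Otherwise alpha = S i. If i >= 2, then S (i-1) = 0 meets the multiples of b. If i = 1, look at b
    + alpha: as S 1 it forces b = 0, as a later S i' it forces b = S (i'-1), so it is a multiple of
    b and alpha is too. *)
Lemma step_multiple : exists2 f, (f < a)%N & alpha = f%:R * b.
Proof.
case: (cover alpha) => [[j _]|[i iS]]; first exact: red.
have [i1|i2] : i = 1%N \/ (2 <= i)%N by lia.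
  move=> e; case: (cover (b + alpha)) => [[j _ e2]|[i' iS']].
    apply: (@red _ (j + (a - 1))); have -> : alpha = (b + alpha) - b by ring.
    by rewrite e2 natrD (natrB _ (ltnW a_gt1)) a0; ring.
  have [->|i2] : i' = 1%N \/ (2 <= i')%N by lia.
    by rewrite -i1 -e => /eqP; rewrite -subr_eq0 addrK => /eqP.
  rewrite -[i'](subnK (ltnW i2)) Sadd mul1r => /addIr e3.
  case: (@disjTS (i' - 1)%N 1%N) => //; first by lia.
  by rewrite mul1r.
rewrite -[i](subnK (ltnW i2)) Sadd mul1r => e.
case: (@disjTS (i - 1)%N 0%N); [lia|lia|].
by rewrite mul0r; apply: (@addIr _ alpha); rewrite add0r.
Qed.

Lemma all_multiples x : exists2 j, (j < a)%N & x = j%:R * b.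
Proof.
have [f _ fE] := step_multiple.
case: (cover x) => [[j _]|[i iS ->]]; first exact: red.
(* S i is l b minus (n-1-i) alpha; the factor a - 1 plays the role of -1 in Z/a. *)
apply: (@red _ (l + (n - 1 - i) * ((a - 1) * f))).
have := Sadd i (n - 1 - i); rewrite subnKC; last by case/andP: iS.
rewrite -lbE => e; have -> : S i = l%:R * b - (n - 1 - i)%:R * (f%:R * b).
  by rewrite -fE e addrK.
by rewrite natrD !natrM (natrB _ (ltnW a_gt1)) a0; ring.
Qed.

Lemma multiple_inj j j' : (j < a)%N -> (j' < a)%N -> j%:R * b = j'%:R * b -> j = j'.
Proof.
move=> ja j'a e; have [u _ uE] := all_multiples 1.
have : j%:R = j'%:R :> 'Z_a.
  have E i : i%:R = u%:R * (i%:R * b) by rewrite mulrCA -uE mulr1.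
  by rewrite (E j) e -(E j').
by move/(congr1 (@nat_of_ord _)); rewrite !val_Zp_nat // !modn_small.
Qed.

(** Since b generates Z/a, the progression consists of the j b with l <= j < a. For j > l such an
    element is not the last term S (n-1) = l b, so adding alpha stays inside the progression
    ([next]). Writing alpha = f b, every f other than a - 1 eventually leaves it. *)
Lemma progression_neg : h = 0 /\ alpha = - b.
Proof.
suff aN : alpha = - b.
  split=> //; have : S (n - 1) = l%:R * b by [].
  rewrite /S aN => /eqP; rewrite -subr_eq0 => /eqP e.
  have -> : h = (h + (n - 1)%:R * - b - l%:R * b) + (n - 1 + l)%:R * b.
    by rewrite natrD; ring.
  by rewrite e -aE a0 mul0r addr0.
have big j : (l <= j)%N -> (j < a)%N -> exists2 i, (1 <= i <= n - 1)%N & j%:R * b = S i.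
  move=> lj ja; case: (cover (j%:R * b)) => [[j' j'l e]|//].
  by move: (multiple_inj ja (ltn_trans j'l (leq_ltn_trans lj ja)) e); lia.
have next j : (l < j)%N -> (j < a)%N ->
    exists2 i, (1 <= i <= n - 1)%N & j%:R * b + alpha = S i.
  move=> lj ja; have [i iS e] := big j (ltnW lj) ja.
  have ni : i <> (n - 1)%N.
    move=> ie; move: e; rewrite ie -lbE => e.
    by move: (multiple_inj ja (ltn_trans lj ja) e); lia.
  by exists i.+1; [lia | rewrite -addn1 Sadd -e mul1r].
have [f fa fE] := step_multiple.
have f0 : f <> 0%N.
  by move=> f0; apply: injS12; rewrite -[2%N]/(1 + 1)%N Sadd fE f0; ring.
(* If f <= a - 2, then (l+1+f) b either wraps around to a multiple below l, or a - f exceeds l and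
   adding alpha to (a-f) b yields 0; both lie outside the progression. Here n >= 3 ensures l + 1 <
   a. *)
have [i iS e] := next l.+1 (ltnSn l) ltac:(lia).
have [fe|fs] : f = (a - 1)%N \/ (f <= a - 2)%N by lia.
  by rewrite fE fe (natrB _ (ltnW a_gt1)) a0; ring.
exfalso; move: e; rewrite fE -mulrDl -natrD => e.
have [le|lt] := leqP a (l.+1 + f).
  apply: (@disjTS i (l.+1 + f - a)%N _ iS); first by lia.
  by rewrite -e natrB // a0 subr0.
have [i' iS' e'] := next (a - f)%N ltac:(lia) ltac:(lia).
apply: (@disjTS i' 0%N _ iS'); first by lia.
by rewrite -e' fE -mulrDl -natrD subnK ?a0 // ltnW.
Qed.

End ResidueProgressions.

(** * The Apery set of a and the integrality relations *)

Section Combinatorics.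
Local Open Scope nat_scope.
Variables (H : numerical_semigroup) (n l h alpha b : nat).
Local Notation a := (multiplicity H).
Hypotheses (n_ge3 : 3 <= n) (l_ge2 : 2 <= l) (alpha_gt0 : 0 < alpha).
Hypothesis aE : a = n - 1 + l.
Hypothesis Hb : nsg_set H b.
Hypothesis lbE : l * b = h + (n - 1) * alpha + a.
Hypothesis PF_notin : forall i, 1 <= i <= n - 1 -> ~ nsg_set H (h + i * alpha).
Hypothesis PF_add : forall i s, 1 <= i <= n - 1 -> nsg_set H s -> 0 < s ->
  nsg_set H (h + i * alpha + s).

Definition in_apery x := nsg_set H x /\ forall y, nsg_set H y -> x <> y + a.

Let a_gt0 : 0 < a := multiplicity_gt0 H.
Let Ha : nsg_set H a := nsg_multiplicity H.

Lemma apery_le x s q q' : in_apery x -> nsg_set H s ->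
  x + q * a = s + q' * a -> q' <= q.
Proof.
move=> [Hx nx] Hs e; rewrite leqNgt; apply/negP => lt.
apply: (nx (s + (q' - q).-1 * a)).
  by apply: nsgD => //; exact: nsgMn.
have : q' = q + ((q' - q).-1).+1 by lia.
move: (q' - q).-1 => d qE; move: e; rewrite qE mulnDl mulSn; lia.
Qed.

Lemma apery_inj x y q q' : in_apery x -> in_apery y ->
  x + q * a = y + q' * a -> x = y /\ q = q'.
Proof.
move=> ax ay e; have le := apery_le ax (proj1 ay) e.
have ge := apery_le ay (proj1 ax) (esym e).
have qq : q = q' by lia.
by split=> //; move: e; rewrite qq; lia.
Qed.

Lemma b_gt0 : 0 < b.
Proof.
rewrite lt0n; apply/eqP => b0; move: lbE a_gt0; rewrite b0 muln0.
by move: (_ * alpha) => z; lia.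
Qed.

Lemma apery_PF i : 1 <= i <= n - 1 -> in_apery (h + i * alpha + a).
Proof.
move=> ib; split; first exact: PF_add.
by move=> y Hy /addIn e; apply: (PF_notin ib); rewrite e.
Qed.

(** The element l b = h + (n-1) alpha + a is in the Apery set, which is closed under taking summands
    in H. *)
Lemma apery_mulb j : j <= l -> in_apery (j * b).
Proof.
move=> jl; split; first exact: nsgMn.
move=> y Hy e; have ib : 1 <= n - 1 <= n - 1 by lia.
apply: (PF_notin ib); have -> : h + (n - 1) * alpha = y + (l - j) * b.
  have : l * b = j * b + (l - j) * b by rewrite -mulnDl subnKC.
  rewrite lbE e; lia.
by apply: nsgD => //; exact: nsgMn.
Qed.

(** With equality, l b - a would be a pseudo-Frobenius number plus the positive element (l-j) b,
    hence in H. *)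
Lemma PF_neq_mulb i j : 1 <= i <= n - 1 -> j < l -> j * b <> h + i * alpha + a.
Proof.
move=> ib jl e; have ib' : 1 <= n - 1 <= n - 1 by lia.
have [_] := apery_PF ib'.
have Hs : nsg_set H (h + i * alpha + (l - j) * b).
  by apply: PF_add => //; [exact: nsgMn | rewrite muln_gt0 b_gt0; lia].
move/(_ _ Hs); apply; rewrite -lbE.
have : l * b = j * b + (l - j) * b by rewrite -mulnDl subnKC // ltnW.
rewrite e; lia.
Qed.

Let elt (j : 'I_a) := if j < l then j * b else h + (j - l).+1 * alpha + a.

Let elt_apery j : in_apery (elt j).
Proof.
rewrite /elt; case: ltnP => [/ltnW/apery_mulb//|lj]; apply: apery_PF.
by have := ltn_ord j; lia.
Qed.

Let elt_inj i j : elt i = elt j -> i = j.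
Proof.
have := ltn_ord i; have := ltn_ord j; rewrite /elt => ja ia.
have b0 := b_gt0.
case: ltnP => il; case: ltnP => jl e; apply: val_inj => /=.
- by apply/eqP; move/eqP: e; rewrite eqn_pmul2r.
- by case: (PF_neq_mulb _ il e); lia.
- by case: (PF_neq_mulb _ jl (esym e)); lia.
- have : (i - l).+1 * alpha = (j - l).+1 * alpha by lia.
  by move/eqP; rewrite eqn_pmul2r // => /eqP; lia.
Qed.

(** The family [elt] consists of a distinct Apery elements; these are pairwise incongruent modulo a,
    so by counting they meet every class. *)
Lemma apery_cover r : exists x, x = r %[mod a] /\
  ((exists2 j, j < l & x = j * b) \/
   (exists2 i, 1 <= i <= n - 1 & x = h + i * alpha + a)).
Proof.
have lt x : x %% a < a by rewrite ltn_mod.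
pose f (j : 'I_a) := Ordinal (lt (elt j)).
have f_inj : injective f.
  move=> i j /(congr1 val) /= e; apply: elt_inj.
  have := divn_eq (elt i) a; have := divn_eq (elt j) a; rewrite e => e1 e2.
  suff /(apery_inj (elt_apery i) (elt_apery j)) [] :
    elt i + elt j %/ a * a = elt j + elt i %/ a * a by [].
  by rewrite {1}e2 {3}e1; lia.
have /codomP [j /(congr1 val) /= e] := injF_onto f_inj (Ordinal (lt r)).
exists (elt j); split=> //; rewrite /elt; case: ltnP => jl; [left|right].
  by exists j.
by exists (j - l).+1 => //; have := ltn_ord j; lia.
Qed.

(** In Z/a, [progression_neg] gives a | h and a | alpha + b. The last relation is l (alpha + b) with
    l b expanded and a = n - 1 + l, divided by a. *)
Lemma residues : exists h1 m,
  [/\ h = a * h1, alpha + b = a * m & l * m = h1 + alpha + 1].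
Proof.
have a1 : 1 < a by lia.
have ZE (x y : nat) : (x%:R = y%:R :> 'Z_a)%R <-> x = y %[mod a].
  split=> [/(congr1 (@nat_of_ord _))|e]; first by rewrite !val_Zp_nat.
  by apply: val_inj; rewrite /= !val_Zp_nat.
have a0 : (a%:R = 0 :> 'Z_a)%R by apply/(ZE a 0); rewrite modnn mod0n.
have apmod x y : in_apery x -> in_apery y -> (x%:R = y%:R :> 'Z_a)%R -> x = y.
  move=> ax ay /ZE e; have := divn_eq x a; have := divn_eq y a; rewrite e => e1 e2.
  suff /(apery_inj ax ay) [] : x + y %/ a * a = y + x %/ a * a by [].
  by rewrite {1}e2 {3}e1; lia.
have SE i : ((h + i * alpha + a)%:R = h%:R + i%:R * alpha%:R :> 'Z_a)%R.
  by rewrite !natrD a0 addr0 natrM.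
have [] := @progression_neg a n l h%:R%R alpha%:R%R b%:R%R a1 n_ge3 l_ge2 aE.
- move=> x; have [y [e]] := apery_cover x.
  have xE : x = (y%:R)%R.
    by rewrite -[x]natr_Zp; apply/ZE.
  case=> [[j jl yE]|[i ib yE]]; [left; exists j => // | right; exists i => //].
    by rewrite xE yE natrM.
  by rewrite xE yE SE.
- move=> i j jl ib; rewrite -natrM -SE => /apmod e.
  by apply: (PF_neq_mulb ib jl); apply: e; [exact/apery_mulb/ltnW | exact: apery_PF].
- move=> e; have := apmod b 0; rewrite mulr0n => /(_ _ _ e).
  have := apery_mulb (ltnW l_ge2); have := apery_mulb (leq0n l); rewrite mul0n mul1n.
  by move=> A B /(_ B A) b0; have := b_gt0; rewrite b0.
- rewrite -!SE => /apmod e.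
  have : h + 1 * alpha + a = h + 2 * alpha + a by apply: e; apply: apery_PF; lia.
  lia.
- by rewrite -natrM -SE lbE.
move=> h0 aN.
have /dvdnP[h1 h1E] : a %| h by rewrite /dvdn -[0](mod0n a); apply/eqP/ZE.
have /dvdnP[m mE] : a %| alpha + b.
  by rewrite /dvdn -[0](mod0n a); apply/eqP/ZE; rewrite natrD aN addNr.
exists h1, m; split; [lia|lia|].
apply/eqP; rewrite -(eqn_pmul2l a_gt0); apply/eqP.
have : l * (alpha + b) = l * (m * a) by rewrite mE.
rewrite mulnDr lbE h1E => e.
have : (n - 1) * alpha + l * alpha = a * alpha by rewrite -mulnDl -aE.
nia.
Qed.

(** * Orders computed from the Apery set *)

Section Reduced.
Variables (h1 m : nat).
Hypotheses (hE : h = a * h1) (mE : alpha + b = a * m) (lmE : l * m = h1 + alpha + 1).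

(** The Apery element congruent to j b; [aperyE] measures the gap, with truncated j - l giving 0 for
    j <= l. *)
Definition apery j := if j <= l then j * b else h + (a - j) * alpha + a.

Lemma aperyE j : j < a -> apery j + (j - l) * m * a = j * b.
Proof.
move=> ja; rewrite /apery; case: leqP => jl.
  by rewrite (eqP jl) !mul0n addn0.
have [d jE] : exists d, j = l + d by exists (j - l); lia.
have [e ae] : exists e, a = j + e by exists (a - j); lia.
have E1 : a - j = e by lia.
have E2 : j - l = d by lia.
rewrite E1 E2.
have : j * (alpha + b) = j * (a * m) by rewrite mE.
have : a * (l * m) = a * (h1 + alpha + 1) by rewrite lmE.
have : a * alpha = (j + e) * alpha by rewrite -ae.
rewrite hE {2 3}jE; nia.
Qed.

Lemma apery_in j : j < a -> in_apery (apery j).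
Proof.
move=> ja; rewrite /apery; case: leqP => jl; first exact: apery_mulb.
by apply: apery_PF; lia.
Qed.

Lemma apery_decomp s : nsg_set H s -> exists j q, j < a /\ s = apery j + q * a.
Proof.
move=> Hs; have [x [xs xE]] := apery_cover s.
have [j [ja xj]] : exists j, j < a /\ x = apery j.
  case: xE => [[j jl ->]|[i ib ->]].
    by exists j; split; [lia | rewrite /apery ltnW].
  exists (a - i); split; first by lia.
  rewrite /apery; case: leqP => ai; last by congr (_ + _ * _ + _); lia.
  have -> : a - i = l by lia.
  by rewrite lbE; congr (_ + _ * _ + _); lia.
have ax := apery_in ja; rewrite -xj in ax.
have le : x %/ a <= s %/ a.
  apply: (apery_le ax Hs); rewrite {1}(divn_eq x a) {2}(divn_eq s a) xs; lia.
exists j, (s %/ a - x %/ a); split=> //; rewrite -xj mulnBl.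
have := divn_eq x a; have := divn_eq s a; rewrite xs.
have : x %/ a * a <= s %/ a * a by rewrite leq_mul2r le orbT.
lia.
Qed.

Lemma apery_uniq j j' q q' : j < a -> j' < a ->
  apery j + q * a = apery j' + q' * a -> j = j' /\ q = q'.
Proof.
move=> ja j'a /(apery_inj (apery_in ja) (apery_in j'a)) [e qq]; split=> //.
have b0 := b_gt0; have PFl i : l < i -> i < a ->  h + (a - i) * alpha + a < l * b.
  move=> li ia; rewrite lbE ltn_add2r ltn_add2l ltn_pmul2r //; lia.
move: e; rewrite /apery; case: leqP => jl; case: leqP => j'l e.
- by apply/eqP; move/eqP: e; rewrite eqn_pmul2r.
- have [jE|lt] : j = l \/ j < l by lia.
    by have := PFl _ j'l j'a; rewrite -e jE ltnn.
  by case: (PF_neq_mulb _ lt e); lia.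
- have [jE|lt] : j' = l \/ j' < l by lia.
    by have := PFl _ jl ja; rewrite e jE ltnn.
  by case: (PF_neq_mulb _ lt (esym e)); lia.
- have : (a - j) * alpha = (a - j') * alpha by lia.
  by move/eqP; rewrite eqn_pmul2r // => /eqP; lia.
Qed.

Definition apery_order j := if j <= l then j else 1.

Lemma apery_order_le j q : j < a -> order_ge H (apery_order j + q) (apery j + q * a).
Proof.
move=> ja; apply: order_geD; last exact: order_ge_multiplicity.
rewrite /apery_order /apery; case: leqP => jl; first exact: order_ge_muln b_gt0.
have [Hs _] : in_apery (h + (a - j) * alpha + a) by apply: apery_PF; lia.
rewrite -[X in order_ge _ _ X]mul1n; apply: order_ge_muln => //.
by rewrite addn_gt0 a_gt0 orbT.
Qed.

(** Adding indices modulo a may lower [apery_order], but each extra step beyond l releases m copies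
    of a, and m >= l makes up the loss. *)
Lemma apery_add j1 j2 : l <= m -> j1 < a -> j2 < a -> exists j3 q3,
  [/\ j3 < a, apery j1 + apery j2 = apery j3 + q3 * a &
      apery_order j1 + apery_order j2 <= apery_order j3 + q3].
Proof.
move=> lm j1a j2a; have := aperyE j1a; have := aperyE j2a.
have Dm D : D * l <= D * m by rewrite leq_mul2l lm orbT.
(* The second bound is (D - 1)(l - 1) >= 0. *)
have Dl D : D <= D * l /\ (0 < D -> D + l <= D * l + 1).
  by case: D => [//|D]; rewrite mulSn; have := leq_pmulr D (ltnW l_ge2); lia.
set d1 := j1 - l; set d2 := j2 - l => E2 E1.
have [lt|ge] := ltnP (j1 + j2) a.
  have E3 := aperyE lt; set d3 := j1 + j2 - l in E3.
  have [D DE] : exists D, d3 = d1 + d2 + D by exists (d3 - d1 - d2); lia.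
  exists (j1 + j2), (D * m); split=> //.
    have : apery j1 + apery j2 + (d1 + d2) * m * a = apery (j1 + j2) + d3 * m * a.
      by rewrite E3; lia.
    rewrite DE; nia.
  have [Dl1 Dl2] := Dl D; have Dm1 := Dm D; rewrite /apery_order /d1 /d2 /d3 in DE *.
  move: (D * m) (D * l) Dl1 Dl2 Dm1 => p r Dl1 Dl2 Dm1.
  by case: (leqP j1 l) => h1l; case: (leqP j2 l) => h2l;
    case: (leqP (j1 + j2) l) => h3l; lia.
have j3a : j1 + j2 - a < a by lia.
have E3 := aperyE j3a; set j3 := j1 + j2 - a in E3 j3a; set d3 := j3 - l in E3.
have [D DE] : exists D, a - l + d3 = d1 + d2 + D.
  by exists (a - l + d3 - d1 - d2); lia.
(* When the index wraps around, a b must be absorbed as a multiple of a. *)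
have abE : a * b = a * (h1 + 1) + (a - l) * m * a.
  have [e ae] : exists e, a = l + e by exists (a - l); lia.
  have -> : a - l = e by lia.
  have : a * (alpha + b) = a * (a * m) by rewrite mE.
  have : a * (a * m) = a * ((l + e) * m) by rewrite {2}ae.
  have : a * (l * m) = a * (h1 + alpha + 1) by rewrite lmE.
  nia.
exists j3, (h1 + 1 + D * m); split=> //.
  have : apery j1 + apery j2 + (d1 + d2) * m * a =
         apery j3 + a * (h1 + 1) + (a - l + d3) * m * a.
    have : j1 * b + j2 * b = j3 * b + a * b by rewrite -!mulnDl; congr (_ * _); lia.
    rewrite -E1 -E2 -E3 abE; lia.
  rewrite DE; nia.
have [Dl1 Dl2] := Dl D; have Dm1 := Dm D; rewrite /apery_order /d1 /d2 /d3 /j3 in DE *.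
move: (D * m) (D * l) Dl1 Dl2 Dm1 => p r Dl1 Dl2 Dm1.
by case: (leqP j1 l) => h1l; case: (leqP j2 l) => h2l;
  case: (leqP (j1 + j2 - a) l) => h3l; lia.
Qed.

Lemma order_ge_apery i j q : l <= m -> j < a ->
  order_ge H i (apery j + q * a) -> i <= apery_order j + q.
Proof.
move=> lm; elim: i j q => [//|i IH] j q ja /= [u [v [Hu u0 iv e]]].
have [j1 [q1 [j1a uE]]] := apery_decomp Hu.
have [j2 [q2 [j2a vE]]] := apery_decomp (order_ge_nsg iv).
have le2 : i <= apery_order j2 + q2 by apply: IH; rewrite -?vE.
have [j3 [q3 [j3a E le3]]] := apery_add lm j1a j2a.
have [jj qq] : j = j3 /\ q = q1 + q2 + q3.
  apply: apery_uniq => //; rewrite e uE vE; lia.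
have [z|] := posnP (apery_order j1 + q1); last by rewrite jj qq; lia.
have [j10 q10] : j1 = 0 /\ q1 = 0.
  by move: z; rewrite /apery_order; case: (leqP j1 l) => _; lia.
by move: u0; rewrite uE j10 q10 /apery leq0n.
Qed.

(** A proper summand must be j b with j < l: a summand h + i alpha + a could give up its a, as h + i
    alpha plus the other summand is in H. Two such multiples sum to some j b with j <= l, excluded
    by uniqueness, or pass l b, from which a can again be subtracted. *)
Lemma apery_irreducible : ~ order_ge H 2 (apery l.+1).
Proof.
have la : l.+1 < a by lia.
have [_ nW] := apery_in la.
move=> /= [u [v [Hu u0 [v' [w [Hv' v'0 Hw vE]]] e]]].
have Hv : nsg_set H v by rewrite vE; exact: nsgD.
have v0 : 0 < v by lia.
have key s t : nsg_set H s -> nsg_set H t -> 0 < t -> apery l.+1 = s + t ->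
    exists2 j, j < l & s = j * b.
  move=> Hs Ht t0 est; have [j [q [ja sE]]] := apery_decomp Hs.
  case: q sE => [|q] sE; last first.
    case: (nW (apery j + q * a + t)); last by rewrite est sE; lia.
    by apply: nsgD => //; apply: nsgD; [case: (apery_in ja) | exact: nsgMn].
  rewrite mul0n addn0 in sE.
  have [jl|lj] := ltnP j l; first by exists j; rewrite // sE /apery ltnW.
  case: (nW (h + (a - j) * alpha + t)); first by apply: PF_add => //; lia.
  rewrite est sE /apery; case: leqP => jl; last by lia.
  have -> : j = l by lia.
  have -> : a - l = n - 1 by lia.
  by rewrite lbE; lia.
have [i il uE] := key u v Hu Hv v0 e.
have [j jl vE'] := key v u Hv Hu u0 ltac:(by rewrite addnC).
have [le|gt] := leqP (i + j) l.
  have ija : i + j < a by lia.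
  have [] : l.+1 = i + j /\ 0 = 0; last by lia.
  apply: apery_uniq => //; rewrite e uE vE' -mulnDl; congr (_ + _).
  by rewrite /apery le.
case: (nW (h + (n - 1) * alpha + (i + j - l) * b)).
  by apply: PF_add; [lia | exact: nsgMn | rewrite muln_gt0 b_gt0; lia].
have : (i + j) * b = l * b + (i + j - l) * b by rewrite -mulnDl subnKC // ltnW.
rewrite mulnDl lbE e uE vE'; lia.
Qed.

Lemma order_regularE :
  (forall i s, nsg_set H s -> order_ge H i.+1 (s + a) -> order_ge H i s) <-> l <= m.
Proof.
split=> [reg|lm i s Hs]; last first.
  have [j [q [ja ->]]] := apery_decomp Hs.
  rewrite -addnA -mulSnr => /(order_ge_apery lm ja) le.
  by apply: order_ge_le (apery_order_le q ja); lia.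
rewrite leqNgt; apply/negP => ml; apply: apery_irreducible.
have la : l.+1 < a by lia.
have [HW _] := apery_in la.
have iter q i s : nsg_set H s -> order_ge H (i + q) (s + q * a) -> order_ge H i s.
  move=> Hs; elim: q => [|q IH]; first by rewrite !addn0.
  rewrite addnS mulSnr addnA => /reg h'; apply/IH/h'.
  by apply: nsgD => //; exact: nsgMn.
(* Here [apery l.+1] + m a = (l+1) b has order at least l + 1 >= m + 2; cancelling a m times leaves
   order at least 2. *)
apply: (iter m) => //; have := aperyE la; rewrite subSnn mul1n => ->.
by apply: order_ge_le (order_ge_muln _ Hb b_gt0); lia.
Qed.

End Reduced.

End Combinatorics.

(** * The three conclusions, read off from the comparison of l with m *)

Theorem theorem4p2 (k : fieldType) (H : numerical_semigroup)
    (n a h alpha l : nat)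
    (n_ge3 : (3 <= n)%N)
    (embdimH : has_embdim H n)
    (multH : multiplicity H = a)
    (stretchedH : stretched (fiber_ring k H))
    (alpha_gt0 : (0 < alpha)%N)
    (PFH : PF H =
      [set (h + i * alpha)%N%:Z | i in [set i : nat | (1 <= i <= n - 1)%N]])
    (lE : l = (a - n + 1)%N)
    (l_ge2 : (2 <= l)%N)
    (l_dvd : (l %| h + (n - 1) * alpha + a)%N)
    (mingensH : minimal_generators H
      ([set a; ((h + (n - 1) * alpha + a) %/ l)%N] `|`
       ([set (h + i * alpha + a)%N | i in [set i : nat | (1 <= i <= n - 1)%N]]
          `\` [set (h + (n - 1) * alpha + a)%N]))) :
  let h1 : rat := h%:R / a%:R in
  let c : rat := (h1 + 1 + alpha%:R) / l%:R in
  [/\ h1 \is a Num.int /\ c \is a Num.int,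
      cohen_macaulay (gr_semigroup_ring k H) <-> l%:R <= c,
      l%:R ^+ 2 - l%:R - alpha%:R <= h1 ->
        cohen_macaulay (gr_semigroup_ring k H) &
      l = 2%N -> cohen_macaulay (gr_semigroup_ring k H)].
Proof.
move=> h1 c; set b := ((h + (n - 1) * alpha + a) %/ l)%N in mingensH.
have aE : multiplicity H = (n - 1 + l)%N by rewrite multH; lia.
have lbE : (l * b = h + (n - 1) * alpha + multiplicity H)%N.
  by rewrite multH mulnC divnK.
have Hb : nsg_set H b.
  have [<- _] := mingensH; exists [:: b]; last by rewrite big_seq1.
  by move=> x /=; rewrite inE => /eqP->; left; right.
have inZE x : inZ H x%:Z -> nsg_set H x by move=> [s Hs [->]].
have PFin i : (1 <= i <= n - 1)%N -> PF H (h + i * alpha)%N%:Z.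
  by move=> ib; rewrite PFH; exists i.
have PF_notin i : (1 <= i <= n - 1)%N -> ~ nsg_set H (h + i * alpha)%N.
  by move=> /PFin[nH _] Hx; apply: nH; exists (h + i * alpha)%N.
have PF_add i s : (1 <= i <= n - 1)%N -> nsg_set H s -> (0 < s)%N ->
    nsg_set H (h + i * alpha + s)%N.
  by move=> /PFin[_ hS] Hs s0; apply: inZE; rewrite PoszD; exact: hS.
have [g1 [m [hE mE lmE]]] :=
  residues n_ge3 l_ge2 alpha_gt0 aE Hb lbE PF_notin PF_add.
have cmE : cohen_macaulay (gr_semigroup_ring k H) <-> (l <= m)%N.
  rewrite gr_cohen_macaulayE.
  exact: (order_regularE n_ge3 l_ge2 alpha_gt0 aE Hb lbE PF_notin PF_add hE mE lmE).
have a_neq0 : a%:R != 0 :> rat by rewrite pnatr_eq0 -multH -lt0n multiplicity_gt0.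
have l_neq0 : l%:R != 0 :> rat by rewrite pnatr_eq0; lia.
have h1E : h1 = g1%:R by rewrite /h1 hE multH natrM mulrAC mulfV ?mul1r.
have cE : c = m%:R.
  rewrite /c h1E; have -> : g1%:R + 1 + alpha%:R = l%:R * m%:R :> rat.
    by rewrite -natrM lmE !natrD addrAC.
  by rewrite mulrAC mulfV ?mul1r.
(* Since b >= a and alpha > 0, the relation alpha + b = a m excludes m <= 1. *)
have m_ge2 : (2 <= m)%N.
  have b0 := b_gt0 n_ge3 l_ge2 alpha_gt0 aE lbE.
  have := multiplicity_le Hb b0; move: mE lmE.
  by case: m {cmE cE} => [|[|m]] //; rewrite ?muln0 ?muln1; lia.
split.
- by rewrite h1E cE !natr_int.
- by rewrite cE ler_nat.
- rewrite h1E => le; apply/cmE.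
  have {}le : (l * l <= g1 + alpha + l)%N.
    by rewrite -(ler_nat rat) natrM !natrD; move: le; rewrite expr2; lra.
  (* If m < l, then l (m+1) <= l l, while l (m+1) = g1 + alpha + 1 + l exceeds the bound on l l. *)
  rewrite leqNgt; apply/negP => ml.
  by have := leq_mul (leqnn l) ml; rewrite mulnS lmE; lia.
- by move=> l2; apply/cmE; rewrite l2.
Qed.
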